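(* Let $d\ge2$ and let $K$ be a $d$-dimensional convex body. Then $\mathrm{coin}(K)\le2N_{1/2}(K)$. Moreover, if $K$ is $o$-symmetric, then $$2N_{1/2}(K)\le3^d(2d)(\ln d+\ln\ln d+5)=O(3^dd\ln d);$$ otherwise, $$2N_{1/2}(K)\le2^{d+1}\left(\binom{2d}{d}^{1/d}-\frac12\right)^dd(\ln d+\ln\ln d+5)=O(7^d\sqrt{d}\ln d).$$
   Context: A $d$-dimensional convex body is a compact convex subset of Euclidean space $\mathbb{E}^d$ with nonempty interior; it is $o$-symmetric if $K=-K$. For $m\in\mathbb{N}=\{1,2,\dots\}$, $\gamma_m(K)=\inf\{\lambda>0:K\subseteq\bigcup_{i=1}^m(\lambda K+t_i),\ t_i\in\mathbb{E}^d\}$. The covering index is $$\mathrm{coin}(K)=\inf\left\{\frac{m}{1-\gamma_m(K)}:\gamma_m(K)\le\tfrac12,\ m\in\mathbb{N}\right\}.$$ $N_{1/2}(K)$ is the minimum number of translates of $\frac12K$ needed to cover $K$. The $O(\cdot)$ notation is as $d\to\infty$, with absolute constants. *)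

(* Defs.v *)
From HB Require Import structures.
From mathcomp Require Import all_boot all_order all_algebra.
From mathcomp Require Import all_classical all_reals all_analysis.

Set Implicit Arguments.
Unset Strict Implicit.
Unset Printing Implicit Defensive.
Import Order.TTheory GRing.Theory Num.Theory.
Import numFieldNormedType.Exports.
Local Open Scope classical_set_scope.
Local Open Scope ring_scope.

(* Euclidean d-space is represented by 'rV[R]_d. The library's uniform
   structure on row vectors comes from the sup norm; it induces the Euclidean
   topology, and only that topology (compactness, interior) is used. *)
Definition convex_body (R : realType) (d : nat) (K : set 'rV[R]_d) : Prop :=
  [/\ compact K, convex_set K & K° !=set0].

Definition o_symmetric (R : realType) (d : nat) (K : set 'rV[R]_d) : Prop :=
  K = [set - x | x in K].

Definition covers (R : realType) (d : nat) (K : set 'rV[R]_d)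
    (m : nat) (lambda : R) : Prop :=
  exists t : 'I_m -> 'rV[R]_d,
    K `<=` \bigcup_(i in [set: 'I_m]) [set lambda *: x + t i | x in K].

(* For 0 < m the set below contains 1 and is bounded below by 0, so the
   real-valued infimum is a genuine one. For m = 0 and K nonempty the set is
   empty and [inf] is the junk value 0, so users of [covgamma] need 0 < m. *)
Definition covgamma (R : realType) (d : nat) (K : set 'rV[R]_d) (m : nat) : R :=
  inf [set lambda : R | 0 < lambda /\ covers K m lambda].

(* Infima in \bar R, so that the empty infimum is +oo rather than junk. *)
Definition coin (R : realType) (d : nat) (K : set 'rV[R]_d) : \bar R :=
  ereal_inf [set (m%:R / (1 - covgamma K m))%:E | m in
    [set m : nat | (0 < m)%N /\ covgamma K m <= 2^-1]].

(* An infimum of natural numbers: a minimum whenever a finite cover exists,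
   and +oo otherwise. *)
Definition covnum (R : realType) (d : nat) (K : set 'rV[R]_d)
    (lambda : R) : \bar R :=
  ereal_inf [set m%:R%:E | m in [set m : nat | covers K m lambda]].

(* Main.v *)
Require Import Defs.
From HB Require Import structures.
From mathcomp Require Import all_boot all_order all_algebra finmap.
From mathcomp Require Import all_classical all_reals all_analysis.
From mathcomp Require Import lra ring zify.

Set Implicit Arguments.
Unset Strict Implicit.
Unset Printing Implicit Defensive.
Import Order.TTheory GRing.Theory Num.Theory.
Import numFieldNormedType.Exports.
Local Open Scope classical_set_scope.
Local Open Scope ring_scope.

(** Write |.| for volume, let [N] be the number of translates of [K/2] needed to
    cover [K], and let [Q = |K - K/2| / |K/2|]. The two bounds on [N] follow from
    [N <= Q * d * (ln d + ln ln d + 5)] ([covnum_le]) and an estimate of [Q] in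
    each case.

    Covering. Fix small [e, dl > 0] and work on a fine grid. A translate of
    [(1 - e - dl) K/2] chosen at random among those meeting the relevant region
    catches a proportion [q = (1 - e - dl)^d / Q] of whatever is still uncovered,
    so [k] greedy choices leave at most a fraction [(1 - q)^k] ([greedy_cover]).
    If a point [y] is missed by the slightly larger translates of [(1 - e) K/2],
    then the whole set [y - dl K/2] is missed by the smaller ones; hence the
    missed points contain a maximal family with disjoint sets [y - S], where
    [S] is a part of [dl K/2] symmetric about some point and of volume at least
    [2^-d |dl K/2|]. The family is small because its sets are packed in the
    leftover, and translates of [K/2] attached to it cover everything missed
    ([cover_at_level]). With [k] about [d ln(2/dl) / q] the second step costs
    only [Q] more translates ([covering_bound]), and [e + dl = 1/(4 d ln d)]
    gives the stated bound for every [d >= 2] ([greedy_parameters]).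

    The ratio [Q]. If [K = -K] then [K - K/2 = (3/2) K] and [Q = 3^d].
    In general [K - K = (K - K/2) + (- K/2)], so the Brunn-Minkowski inequality
    and the Rogers-Shephard inequality [|K - K| <= C(2d,d) |K|] yield
    [|K - K/2|^(1/d) <= (C(2d,d)^(1/d) - 1/2) |K|^(1/d)]
    ([vol_half_difference]).

    Volume. The volume [vol] is the limit, along a fixed ultrafilter, of the
    normalised number of grid points. It is defined, monotone and superadditive
    on all bounded sets, and at least the product of the sides on boxes. This
    suffices for the Brunn-Minkowski inequality by the Hadwiger-Ohmann cutting
    argument ([brunn_minkowski_boxes]) and makes the volume homogeneous on
    convex bodies ([vol_homogeneous]). Averaging arguments, which would use
    Fubini's theorem for an integral, are exact double counts at a fixed grid
    level ([sum_hits_ge], [sum_hits_le]).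

    The first claim, [coin K <= 2 N], holds because [m] translates of [K/2]
    covering [K] give [covgamma K m <= 1/2], hence [m / (1 - covgamma K m) <= 2 m].
    For the growth rate, [C(2d,d) <= 4^d / sqrt d] gives [C(2d,d)^(1/d) <= 4 s]
    with [s = d^(-1/(2d)) <= 1], and then [4 s - 1/2 <= (7/2) s]. *)

(** * Greedy covering and packing in an abelian group *)

Section Combinatorics.
Variable Z : zmodType.
Implicit Types (X B T S Y V U J : seq Z) (t x y z : Z).

Definition hits U B t : nat := count (fun u => u - t \in B) U.

Lemma sum_seq_const U (c : nat) : (\sum_(u <- U) c = size U * c)%N.
Proof. by rewrite big_const_seq count_predT iter_addn_0 mulnC. Qed.

Lemma sum_hitsE U B T :
  (\sum_(t <- T) hits U B t = \sum_(u <- U) count (fun t => (u - t)%R \in B) T)%N.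
Proof.
rewrite (eq_bigr (fun t => \sum_(u <- U) ((u - t)%R \in B : nat))%N); last first.
  by move=> t _; rewrite /hits -sum1_count big_mkcond; apply: eq_bigr => u _; case: ifP.
rewrite exchange_big; apply: eq_bigr => u _.
by rewrite -sum1_count [RHS]big_mkcond; apply: eq_bigr => t _; case: ifP.
Qed.

(** Exchanging the sums, each [x] in [U] lies in [t + B] exactly for the
    [t = x - b], and all of these are in [T]. *)
Lemma sum_hits_ge U B T : uniq B ->
  (forall x b, x \in U -> b \in B -> x - b \in T) ->
  (size U * size B <= \sum_(t <- T) hits U B t)%N.
Proof.
move=> uB UBT; rewrite sum_hitsE -sum_seq_const.
rewrite [X in (X <= _)%N]big_seq [X in (_ <= X)%N]big_seq.
apply: leq_sum => u uU.
rewrite -(size_map (fun b => u - b) B) -size_filter.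
apply: uniq_leq_size; first by rewrite map_inj_uniq // => b b' /addrI/oppr_inj.
move=> _ /mapP[b bB ->]; rewrite mem_filter UBT // andbT.
by rewrite opprB addrC subrK.
Qed.

(** For fixed [u], the map [t |-> u - t] sends the [t] counted injectively
    into [B]. *)
Lemma sum_hits_le U B T : uniq T ->
  (\sum_(t <- T) hits U B t <= size U * size B)%N.
Proof.
move=> uT; rewrite sum_hitsE -sum_seq_const.
apply: leq_sum => u _.
rewrite -size_filter -(size_map (fun t => u - t)).
apply: uniq_leq_size.
  by rewrite map_inj_uniq ?filter_uniq // => b b' /addrI/oppr_inj.
by move=> _ /mapP[t + ->]; rewrite mem_filter => /andP[].
Qed.

Lemma exists_hits_ge U B T : (0 < size T)%N -> uniq B ->
  (forall x b, x \in U -> b \in B -> x - b \in T) ->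
  exists2 t, t \in T & (size U * size B <= size T * hits U B t)%N.
Proof.
move=> T0 uB UBT; apply/hasP; apply: contraT; rewrite -all_predC => /allP h.
have := sum_hits_ge uB UBT; rewrite leqNgt => /negP[].
rewrite -(ltn_pmul2l T0) big_distrr /=.
case: T T0 UBT h => // t0 T _ UBT h.
rewrite big_cons.
have h0 := h t0 (mem_head _ _); rewrite /= -ltnNge in h0.
rewrite -addSn mulSn leq_add //.
rewrite -[X in (_ <= X)%N]sum_seq_const big_seq [X in (_ <= X)%N]big_seq.
apply: leq_sum => t tT; apply: ltnW; rewrite ltnNge; apply: h.
by rewrite in_cons tT orbT.
Qed.

Definition uncovered X B (ts : seq Z) :=
  [seq x <- X | ~~ has (fun t => x - t \in B) ts].

(** By averaging over [T], some translate of [B] catches at least the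
    proportion [|B| / |T|] of any subset of [X]; remove it and repeat. *)
Lemma greedy_cover (R : realFieldType) X B T k : (0 < size T)%N -> uniq B ->
  (forall x b, x \in X -> b \in B -> x - b \in T) ->
  exists2 ts, size ts = k &
    (size (uncovered X B ts))%:R <=
      (size X)%:R * (1 - (size B)%:R / (size T)%:R) ^+ k :> R.
Proof.
move=> T0 uB XBT; elim: k => [|k [ts szts IH]].
  by exists [::] => //; rewrite expr0 mulr1 ler_nat size_filter count_size.
have UBT x b : x \in uncovered X B ts -> b \in B -> x - b \in T.
  by rewrite mem_filter => /andP[_]; exact: XBT.
have [t tT ht] := exists_hits_ge T0 uB UBT.
have T0' : 0 < (size T)%:R :> R by rewrite ltr0n.
case: (ltnP (size T) (size B)) => BT.
  (* a point of X would have more than [size T] differences x - b in T *)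
  case: X XBT {IH UBT ht} => [|x X] XBT.
    by exists (nseq k.+1 t); [exact: size_nseq | rewrite mul0r].
  suff : (size [seq (x - b)%R | b <- B] <= size T)%N.
    by rewrite size_map leqNgt BT.
  apply: uniq_leq_size; first by rewrite map_inj_uniq // => b b' /addrI/oppr_inj.
  by move=> _ /mapP[b bB ->]; apply: XBT => //; rewrite mem_head.
have q0 : 0 <= 1 - (size B)%:R / (size T)%:R :> R.
  by rewrite subr_ge0 ler_pdivrMr // mul1r ler_nat.
exists (t :: ts); first by rewrite /= szts.
set U := uncovered X B ts in IH UBT ht.
have -> : size (uncovered X B (t :: ts)) = (size U - hits U B t)%N.
  rewrite /hits -(count_predC (fun u => u - t \in B) U) addKn.
  rewrite /U /uncovered !size_filter count_filter.
  by apply: eq_count => x /=; rewrite negb_or.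
rewrite natrB; last by rewrite /hits count_size.
rewrite exprSr mulrA.
apply: le_trans (ler_wpM2r q0 IH).
rewrite mulrBr mulr1 lerD2l lerN2 mulrA ler_pdivrMr // -!natrM ler_nat.
by rewrite [X in (_ <= X)%N]mulnC.
Qed.

(** Keep a point [y0], discard the points whose set [y - S] meets [y0 - S],
    and recurse inside [V] deprived of [y0 - S]. Every discarded point collides
    with a point that was kept. *)
Lemma maximal_packing Y S V : uniq S -> uniq V ->
  (forall y s, y \in Y -> s \in S -> y - s \in V) ->
  exists J : seq Z, [/\ (size J * size S <= size V)%N, {subset J <= Y} &
    forall y, y \in Y -> (0 < size S)%N ->
      exists y' s s', [/\ y' \in J, s \in S, s' \in S & y - s = y' - s']].
Proof.
move=> uS; have [m] := ubnP (size Y).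
elim: m Y V => // m IH [|y0 Y] V /= szY uV YSV; first by exists [::].
pose col y := has (fun s => has (fun s' => y - s == y0 - s') S) S.
pose Y' := [seq y <- Y | ~~ col y].
pose V' := [seq v <- V | v \notin [seq y0 - s | s <- S]].
have [||y s|J [szJ JY' Jmax]] := IH Y' V'.
- by rewrite size_filter (leq_ltn_trans (count_size _ _)).
- exact: filter_uniq.
- rewrite mem_filter => /andP[/hasPn nc yY] sS; rewrite mem_filter.
  rewrite YSV ?in_cons ?yY ?orbT // andbT; apply/negP => /mapP[s' s'S e].
  by have /hasPn/(_ s' s'S) := nc _ sS; rewrite e eqxx.
exists (y0 :: J); split.
- rewrite /= mulSn.
  have <- : (size [seq (y0 - s)%R | s <- S] + size V' = size V)%N.
    rewrite -(count_predC (mem [seq y0 - s | s <- S]) V) size_filter.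
    congr (_ + _)%N; rewrite -size_filter; apply: perm_size; apply: uniq_perm.
    + by rewrite map_inj_uniq // => b b' /addrI/oppr_inj.
    + exact: filter_uniq.
    + move=> v; rewrite mem_filter /=; apply/idP/idP => [vS|/andP[]//].
      by rewrite vS; case/mapP: vS => s sS ->; apply: YSV; rewrite ?mem_head.
  by rewrite size_map leq_add2l.
- by move=> y; rewrite !inE => /orP[->//|/JY']; rewrite mem_filter => /andP[_ ->];
    rewrite orbT.
- move=> y; rewrite inE => /orP[/eqP ->|yY] S0.
    have sS : head y0 S \in S by rewrite -nth0 mem_nth.
    by exists y0, (head y0 S), (head y0 S); rewrite mem_head.
  have [cy|ncy] := boolP (col y).
    have /hasP[s sS /hasP[s' s'S /eqP e]] := cy.
    by exists y0, s, s'; rewrite mem_head.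
  have [|y' [s [s' [y'J sS s'S e]]]] := Jmax y _ S0.
    by rewrite mem_filter ncy.
  by exists y', s, s'; rewrite inE y'J orbT.
Qed.
End Combinatorics.

(** * Grid points and volume *)

Section UltraLimit.
(** A limit along an ultrafilter exists for every bounded sequence and is
    additive and monotone, so no convergence of point counts has to be proved. *)
Definition ufil : set_system nat :=
  projT1 (cid (ultraFilterLemma (eventually_filter : ProperFilter \oo))).

Global Instance ufil_ultra : UltraFilter ufil.
Proof. by rewrite /ufil; case: cid => F /= []. Qed.

Global Instance ufil_proper : ProperFilter ufil.
Proof. exact: ultra_proper. Qed.

Lemma oo_ufil : \oo `<=` ufil.
Proof. by rewrite /ufil; case: cid => F /= []. Qed.

Lemma cvg_oo_ufil (T : topologicalType) (f : nat -> T) (l : T) : f @ \oo --> l -> f @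
  ufil --> l.
Proof. by move=> fl B /fl; exact: oo_ufil. Qed.

Lemma bounded_cvg_ufil (R : realType) (f : nat -> R) c :
  (forall n, 0 <= f n <= c) -> f @ ufil --> lim (f @ ufil).
Proof.
move=> fc; suff [p fp] : exists p : R, f @ ufil --> p by apply/cvg_ex; exists p.
have [|p [_ clp]] := @segment_compact R 0 c (f @ ufil) _.
  suff h : ufil (f @^-1` `[0, c]) by [].
  by apply: filterE => n; rewrite /= in_itv /=; exact: fc.
exists p => B Bp; have [//|nB] := in_ultra_setVsetC (f @^-1` B) ufil_ultra.
by have [x [/= nBx Bx]] := clp (~` B) B nB Bp.
Qed.

End UltraLimit.

Section Grid.
Variables (R : realType) (d : nat).
Implicit Types (A B C K : set 'rV[R]_d) (x y z : 'rV[R]_d) (u v w : 'rV[int]_d).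

Definition bnd A := exists M : R, forall x, A x -> forall i, `|x 0 i| <= M.

Lemma sub_bnd A B : A `<=` B -> bnd B -> bnd A.
Proof. by move=> AB [M BM]; exists M => x /AB; exact: BM. Qed.

Definition grid_pt n u : 'rV[R]_d := \row_i ((u 0 i)%:~R / n.+1%:R).

Lemma grid_ptD n u v : grid_pt n (u + v) = grid_pt n u + grid_pt n v.
Proof. by apply/rowP => i; rewrite !mxE rmorphD mulrDl. Qed.

Lemma grid_ptN n u : grid_pt n (- u) = - grid_pt n u.
Proof. by apply/rowP => i; rewrite !mxE rmorphN mulNr. Qed.

Lemma grid_ptB n u v : grid_pt n (u - v) = grid_pt n u - grid_pt n v.
Proof. by rewrite grid_ptD grid_ptN. Qed.

Lemma near_grid_pt n x : exists u, forall i, `|x 0 i - grid_pt n u 0 i| <= n.+1%:R^-1.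
Proof.
exists (\row_i Num.floor (x 0 i * n.+1%:R)) => i; rewrite !mxE.
have n0 : 0 < n.+1%:R :> R by rewrite ltr0n.
set y := x 0 i; rewrite -[in X in `|X - _|](mulfK (lt0r_neq0 n0) y) -mulrBl.
rewrite normrM normfV (gtr0_norm n0) -[leRHS]mul1r ler_pM2r ?invr_gt0 //.
have := floor_itv (y * n.+1%:R) => /andP[h1 h2].
rewrite ger0_norm ?subr_ge0 // lerBlDr; apply: ltW; apply: lt_le_trans h2 _.
by rewrite intrD addrC.
Qed.

(** The integer points of a cube, as the image of a finite type; this gives
    both the finiteness and an upper bound of point counts. *)
Definition window (N : nat) (f : {ffun 'I_d -> 'I_(2 * N).+1}) : 'rV[int]_d :=
  \row_i ((f i)%:Z - N%:Z).

Lemma window_surj N u : (forall i, (`|(u 0%R i)| <= N)%N) -> exists f, u = @window N f.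
Proof.
move=> uN; exists [ffun i => inord (absz (u 0 i + N%:Z)%R)]; apply/rowP => i.
have := uN i; rewrite !mxE ffunE => h.
have h0 : 0 <= u 0 i + N%:Z by lia.
rewrite inordK; last lia.
lia.
Qed.

Definition pts n A : seq 'rV[int]_d := enum_fset (fset_set [set u | A (grid_pt n u)]).

Definition cnt n A := size (pts n A).

Lemma pts_uniq n A : uniq (pts n A).
Proof. exact: fset_uniq. Qed.

Lemma grid_pt_window n A M : (forall x, A x -> forall i, `|x 0 i| <= M) ->
  [set u | A (grid_pt n u)] `<=`
  [set @window ((Num.truncn M).+1 * n.+1) f | f in [set: {ffun 'I_d -> _}]].
Proof.
move=> AM u /= /AM uM.
case: (@window_surj ((Num.truncn M).+1 * n.+1) u) => [i|f ->]; last by exists f.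
have := uM i; rewrite mxE normrM normfV (@ger0_norm _ n.+1%:R) //.
rewrite ler_pdivrMr ?ltr0n // => h.
have M0 : 0 <= M by apply: le_trans (normr_ge0 _) (uM i).
have := truncn_itv M0 => /andP[_ h2].
rewrite -(ler_nat R) natrM.
apply: le_trans (_ : M * n.+1%:R <= _); last by rewrite ler_wpM2r // ltW.
by apply: le_trans h; rewrite -intr_norm natr_absz.
Qed.

Lemma finite_grid_pt n A : bnd A -> finite_set [set u | A (grid_pt n u)].
Proof.
move=> [M /grid_pt_window h]; apply: sub_finite_set (h n) _; apply: finite_image.
exact: finite_finset.
Qed.

Lemma mem_ptsP n A u : bnd A -> reflect (A (grid_pt n u)) (u \in pts n A).
Proof.
move=> bA; apply: (iffP idP).
  by rewrite /pts in_fset_set; [rewrite inE | exact: finite_grid_pt].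
by move=> h; rewrite /pts in_fset_set; [rewrite inE | exact: finite_grid_pt].
Qed.

Lemma cnt_mono n A B : bnd B -> A `<=` B -> (cnt n A <= cnt n B)%N.
Proof.
move=> bB AB; apply: uniq_leq_size; first exact: pts_uniq.
by move=> u /mem_ptsP -/(_ (sub_bnd AB bB)) /AB ?; apply/mem_ptsP.
Qed.

Lemma cnt_disjoint n A B C : bnd C -> A `<=` C -> B `<=` C -> A `&` B `<=` set0 ->
  (cnt n A + cnt n B <= cnt n C)%N.
Proof.
move=> bC sAC sBC AB; rewrite /cnt -size_cat; apply: uniq_leq_size.
  rewrite cat_uniq !pts_uniq /= andbT; apply/hasPn => u.
  move=> /mem_ptsP -/(_ (sub_bnd sBC bC)) Bu; apply/negP.
  by move=> /mem_ptsP -/(_ (sub_bnd sAC bC)) Au; exact: (AB (grid_pt n u)).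
move=> u; rewrite mem_cat => /orP[] /mem_ptsP h; apply/mem_ptsP => //.
  exact: sAC _ (h (sub_bnd sAC bC)).
exact: sBC _ (h (sub_bnd sBC bC)).
Qed.

Lemma cntN n A : bnd A -> cnt n [set - x | x in A] = cnt n A.
Proof.
move=> bA; have bA' : bnd [set - x | x in A].
  by case: bA => M h; exists M => _ [x Ax <-] i; rewrite mxE normrN h.
rewrite /cnt -(size_map (fun v => - v) (pts n A)); apply: perm_size; apply: uniq_perm.
- exact: pts_uniq.
- by rewrite map_inj_uniq ?pts_uniq //; exact: oppr_inj.
move=> u; apply/mem_ptsP/mapP => // [[x Ax xu]|[v /mem_ptsP h ->]].
  by exists (- u); rewrite ?opprK //; apply/mem_ptsP => //; rewrite grid_ptN -xu opprK.
by exists (grid_pt n v); [exact: h | rewrite grid_ptN].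
Qed.

Definition dens A n : R := (cnt n A)%:R / n.+1%:R ^+ d.

Lemma dens_ge0 A n : 0 <= dens A n.
Proof. by rewrite divr_ge0 ?ler0n ?exprn_ge0. Qed.

Lemma dens_bounded A : bnd A -> exists c, forall n, 0 <= dens A n <= c.
Proof.
move=> [M AM]; exists ((2 * (Num.truncn M).+1).+1%:R ^+ d) => n.
rewrite dens_ge0 /= ler_pdivrMr ?exprn_gt0 ?ltr0n //.
rewrite -exprMn -natrM -natrX ler_nat.
set N := ((Num.truncn M).+1 * n.+1)%N.
apply: leq_trans (_ : (2 * N).+1 ^ d <= _)%N; last first.
  by case: (d) => // d'; rewrite leq_exp2r // /N; lia.
have -> : ((2 * N).+1 ^ d = size (map (@window N) (enum {: {ffun 'I_d -> 'I_(2 *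
  N).+1}})))%N.
  by rewrite size_map -cardE card_ffun !card_ord.
apply: uniq_leq_size; first exact: pts_uniq.
move=> u /mem_ptsP h.
have [f _ <-] := grid_pt_window AM (h (ex_intro _ M AM)).
by apply/mapP; exists f; rewrite ?mem_enum.
Qed.

Definition vol A : R := lim (dens A @ ufil).

Lemma cvg_dens A : bnd A -> dens A @ ufil --> vol A.
Proof. by move=> /dens_bounded[c h]; exact: bounded_cvg_ufil h. Qed.

Lemma vol_le A B : bnd B -> A `<=` B -> vol A <= vol B.
Proof.
move=> bB AB; apply: ler_cvg_to (cvg_dens (sub_bnd AB bB)) (cvg_dens bB) _.
by apply: filterE => n; rewrite ler_pM2r ?invr_gt0 ?exprn_gt0 // ler_nat cnt_mono.
Qed.

Lemma vol_disjoint A B C : bnd C -> A `<=` C -> B `<=` C -> A `&` B `<=` set0 ->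
  vol A + vol B <= vol C.
Proof.
move=> bC sAC sBC AB.
apply: ler_cvg_to (cvgD (cvg_dens (sub_bnd sAC bC)) (cvg_dens (sub_bnd sBC bC)))
  (cvg_dens bC) _.
apply: filterE => n /=.
rewrite /dens -[leLHS]mulrDl ler_pM2r ?invr_gt0 ?exprn_gt0 //.
by rewrite -natrD ler_nat (cnt_disjoint n bC).
Qed.

Lemma vol_ge0 A : bnd A -> 0 <= vol A.
Proof.
move=> bA; apply: ler_cvg_to (cvg_cst 0) (cvg_dens bA) _.
by apply: filterE => n; exact: dens_ge0.
Qed.

End Grid.

(** * The Brunn-Minkowski inequality for unions of boxes *)

Section Boxes.
Variables (R : realType) (d : nat).

Definition box := ('rV[R]_d * 'rV[R]_d)%type.
Implicit Types (p q : box) (A B : seq box) (C : set 'rV[R]_d).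

Definition bset p : set 'rV[R]_d := [set x | forall i, p.1 0 i <= x 0 i < p.2 0 i].
Definition side p i : R := Num.max (p.2 0 i - p.1 0 i) 0.
Definition bvol p : R := \prod_i side p i.
Definition nondeg p := [forall i, p.1 0 i < p.2 0 i].

Lemma side_ge0 p i : 0 <= side p i.
Proof. by rewrite le_max lexx orbT. Qed.

Lemma bvol_ge0 p : 0 <= bvol p.
Proof. by apply: prodr_ge0 => i _; exact: side_ge0. Qed.

Lemma nondeg_side p i : nondeg p -> side p i = p.2 0 i - p.1 0 i.
Proof. by move=> /forallP/(_ i) h; rewrite /side max_l // subr_ge0 ltW. Qed.

Lemma side_nondeg_gt0 p i : nondeg p -> 0 < side p i.
Proof. by move=> np; rewrite nondeg_side // subr_gt0; exact: (forallP np i). Qed.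

Lemma bvol_gt0 p : nondeg p -> 0 < bvol p.
Proof. by move=> np; apply: prodr_gt0 => i _; exact: side_nondeg_gt0. Qed.

Lemma bvol_degenerate p : ~~ nondeg p -> bvol p = 0.
Proof.
move=> /forallPn[i]; rewrite -leNgt => h; apply/eqP/prodf_eq0; exists i => //.
by rewrite /side max_r // subr_le0.
Qed.

Lemma bnd_bset p : bnd (bset p).
Proof.
exists (\sum_i (`|p.1 0 i| + `|p.2 0 i|)) => x px i; have /andP[h1 h2] := px i.
rewrite (bigD1 i) //=; apply: le_trans (_ : `|p.1 0 i| + `|p.2 0 i| <= _); last first.
  by rewrite lerDl sumr_ge0 // => j _; rewrite addr_ge0.
rewrite ler_norml; apply/andP; split.
  have := ler_norm (- p.1 0 i); rewrite normrN => h3.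
  have := normr_ge0 (p.2 0 i); lra.
have := ler_norm (p.2 0 i); have := normr_ge0 (p.1 0 i); lra.
Qed.

(** A half-open interval of length [l] contains at least [truncn l] integers,
    namely the first ones from the ceiling of its left end. *)
Lemma cnt_box n p :
  (\prod_i Num.truncn (side p i * n.+1%:R) <= cnt n (bset p))%N.
Proof.
pose m i := Num.truncn (side p i * n.+1%:R).
pose g (f : {dffun forall i, 'I_(m i)}) : 'rV[int]_d :=
  \row_i (Num.ceil (p.1 0 i * n.+1%:R) + (f i)%:Z).
have ginj : injective g.
  move=> f f' /rowP e; apply/ffunP => i; apply/val_inj.
  by have := e i; rewrite !mxE => /addrI[].
have -> : (\prod_i Num.truncn (side p i * n.+1%:R) = size (map g (enum {: {dffun
  forall i, 'I_(m i)}})))%N.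
  rewrite size_map -cardE card_dep_ffun foldrE big_map big_enum /=.
  by apply: eq_bigr => i _; rewrite card_ord.
apply: uniq_leq_size; first by rewrite map_inj_uniq ?enum_uniq.
move=> _ /mapP[f _ ->]; apply/mem_ptsP; first exact: bnd_bset.
move=> i; rewrite !mxE.
have n0 : 0 < n.+1%:R :> R by rewrite ltr0n.
have fi : ((f i).+1%:R <= side p i * n.+1%:R :> R).
  have := truncn_itv (mulr_ge0 (side_ge0 p i) (ltW n0)) => /andP[h _].
  by apply: le_trans h; rewrite ler_nat.
have s0 : 0 < side p i.
  by rewrite -(pmulr_lgt0 _ n0); apply: lt_le_trans fi; rewrite ltr0n.
have e : side p i = p.2 0 i - p.1 0 i.
  by move: s0; rewrite /side lt_max ltxx orbF => /ltW s0; rewrite max_l.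
rewrite ler_pdivlMr // ltr_pdivrMr // intrD.
have := ceil_itv (p.1 0 i * n.+1%:R) => /andP[h1 h2].
apply/andP; split; first by rewrite -[leLHS]addr0 lerD.
move: fi h1 h2; rewrite e mulrBl -natr1 intrB => fi h1 h2.
rewrite -pmulrn; lra.
Qed.

Lemma bvol_le_vol p : bvol p <= vol (bset p).
Proof.
pose w n := \prod_i ((Num.truncn (side p i * n.+1%:R))%:R / n.+1%:R) : R.
have wcvg : w n @[n --> \oo] --> bvol p.
  apply: cvg_big; first exact: mul_continuous.
  move=> i _.
  apply: (@squeeze_cvgr _ _ _ _ (fun n => side p i - harmonic n) (fun=> side p i)).
  - apply: nearW => n; have n0 : 0 < n.+1%:R :> R by rewrite ltr0n.
    have := truncn_itv (mulr_ge0 (side_ge0 p i) (ltW n0)) => /andP[h1 h2].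
    rewrite ler_pdivrMr // h1 andbT ler_pdivlMr // mulrBl /= mulVf ?gt_eqF //.
    by rewrite lerBlDr natr1 ltW.
  - rewrite -[X in _ --> X]subr0; apply: cvgB; [exact: cvg_cst | exact: cvg_harmonic].
  - exact: cvg_cst.
apply: ler_cvg_to (cvg_oo_ufil wcvg) (cvg_dens (bnd_bset p)) _.
apply: filterE => n; rewrite /w /dens prodf_div prodr_const card_ord.
by rewrite ler_pM2r ?invr_gt0 ?exprn_gt0 ?ltr0n // -natr_prod ler_nat cnt_box.
Qed.

Definition below i t p : box := (p.1, \row_j if j == i then Num.min (p.2 0 j) t else
  p.2 0 j).
Definition above i t p : box := (\row_j (if j == i then Num.max (p.1 0 j) t else p.1
  0 j), p.2).

Lemma cut_length (a b t : R) :
  Num.max (b - a) 0 = Num.max (Num.min b t - a) 0 + Num.max (b - Num.max a t) 0.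
Proof.
case: (leP b t) => h1.
  by rewrite (@max_r _ _ (b - Num.max a t)) ?addr0 // subr_le0 le_max h1 orbT.
case: (leP a t) => h2.
  have h3 := le_trans h2 (ltW h1).
  by rewrite !max_l ?subr_ge0 ?(ltW h1) //; ring.
by rewrite (@max_r _ _ (t - a)) ?add0r // subr_le0 ltW.
Qed.

(** [side] is truncated at [0], so that the identity also holds when one of the
    two parts is degenerate. *)
Lemma bvol_split i t p : bvol p = bvol (below i t p) + bvol (above i t p).
Proof.
have D1 q : bvol q = side q i * \prod_(j | j != i) side q j.
  by rewrite /bvol (bigD1 i).
rewrite 3!D1 [in X in _ = X + _](eq_bigr (side p)); last first.
  by move=> j /negPf ji; rewrite /side mxE ji.
rewrite [in X in _ = _ + X](eq_bigr (side p)); last first.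
  by move=> j /negPf ji; rewrite /side mxE ji.
by rewrite -mulrDl /side !mxE eqxx -cut_length.
Qed.

Lemma belowP i t p x : bset (below i t p) x <-> bset p x /\ x 0 i < t.
Proof.
split=> [h|[px xt] j].
  split=> [j|]; last by have := h i; rewrite mxE eqxx lt_min => /andP[_ /andP[]].
  by have := h j; rewrite !mxE; case: ifP => // _; rewrite lt_min andbA => /andP[].
by have := px j; rewrite mxE; case: eqP => // ->; rewrite lt_min xt andbT.
Qed.

Lemma aboveP i t p x : bset (above i t p) x <-> bset p x /\ t <= x 0 i.
Proof.
split=> [h|[px xt] j].
  split=> [j|]; last by have := h i; rewrite mxE eqxx ge_max => /andP[/andP[]].
  have := h j; rewrite !mxE; case: ifP => // _; rewrite ge_max.
  by move=> /andP[/andP[-> _] ->].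
by have := px j; rewrite mxE; case: eqP => // ->; rewrite ge_max xt andbT.
Qed.

Lemma bvol_below_continuous i p : continuous (fun t => bvol (below i t p)).
Proof.
move=> t; rewrite /bvol; apply: cvg_big => [|j _]; first exact: mul_continuous.
rewrite /side /= !mxE; case: eqP => ji; last first.
  under eq_fun do rewrite mxE (introF eqP ji); exact: cvg_cst.
under eq_fun do rewrite mxE (introT eqP ji).
apply: (@continuous_max R _ (fun t => Num.min (p.2 0 j) t - p.1 0 j) (fun=> 0)); last
  exact: cvg_cst.
apply: cvgB; last exact: cvg_cst.
by apply: (@continuous_min R _ (fun=> p.2 0 j) id); [exact: cvg_cst | exact: cvg_id].
Qed.

(** Disjointness of nonempty boxes in its combinatorial form: a coordinate
    hyperplane separates them. It is this hyperplane that is used as a cut. *)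
Definition sep p q := [exists i, (p.2 0 i <= q.1 0 i) || (q.2 0 i <= p.1 0 i)].

Lemma sep_sub p q p' q' :
  (forall i, p.1 0 i <= p'.1 0 i) -> (forall i, p'.2 0 i <= p.2 0 i) ->
  (forall i, q.1 0 i <= q'.1 0 i) -> (forall i, q'.2 0 i <= q.2 0 i) ->
  sep p q -> sep p' q'.
Proof.
move=> p1 p2 q1 q2 /existsP[i h]; apply/existsP; exists i.
move: (p1 i) (p2 i) (q1 i) (q2 i) => ? ? ? ?.
by case/orP: h => h; apply/orP; [left | right]; lra.
Qed.

Definition tvol A := \sum_(p <- A) bvol p.

Definition cut (f : box -> box) A := [seq p <- map f A | nondeg p].

Lemma tvol_cut f A : tvol (cut f A) = \sum_(p <- A) bvol (f p).
Proof.
rewrite /tvol big_filter big_map [RHS](bigID (fun p => nondeg (f p))) /=.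
by rewrite [X in _ + X]big1 ?addr0 // => p; exact: bvol_degenerate.
Qed.

Lemma tvol_split i t A : tvol A = tvol (cut (below i t) A) + tvol (cut (above i t) A).
Proof.
by rewrite !tvol_cut -big_split; apply: eq_bigr => p _; exact: bvol_split.
Qed.

Lemma size_cut f A : (size (cut f A) <= size A)%N.
Proof. by rewrite size_filter (leq_trans (count_size _ _)) ?size_map. Qed.

Lemma size_cut_lt f A p : p \in A -> ~~ nondeg (f p) -> (size (cut f A) < size A)%N.
Proof.
move=> pA np; rewrite size_filter -(size_map f) ltnNge; apply/negP => h.
have : all nondeg (map f A) by rewrite all_count eqn_leq count_size h.
by move=> /allP/(_ _ (map_f f pA)); exact/negP.
Qed.

Definition shrinks (f : box -> box) := forall p i, p.1 0 i <= (f p).1 0 i /\ (f p).2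
  0 i <= p.2 0 i.

Lemma below_shrinks i t : shrinks (below i t).
Proof.
by move=> p j /=; rewrite mxE; case: ifP => // _; rewrite lexx ge_min lexx.
Qed.

Lemma above_shrinks i t : shrinks (above i t).
Proof.
by move=> p j /=; rewrite mxE; case: ifP => // _; rewrite lexx le_max lexx.
Qed.

Lemma sep_cut f A : shrinks f -> pairwise sep A -> pairwise sep (cut f A).
Proof.
move=> fs sA; apply: subseq_pairwise (filter_subseq _ _) _; rewrite pairwise_map.
by apply: sub_pairwise sA => p q; apply: sep_sub => i; case: (fs p i); case: (fs q i).
Qed.

Lemma all_nondeg_cut f A : all nondeg (cut f A).
Proof. exact: filter_all. Qed.

Lemma tvol_gt0 A p : p \in A -> nondeg p -> 0 < tvol A.
Proof.
move=> pA np; rewrite /tvol (big_rem p pA) /= ltr_pwDl ?bvol_gt0 //.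
by apply: sumr_ge0 => q _; exact: bvol_ge0.
Qed.

Lemma tvol_gt0_size A : 0 < tvol A -> (0 < size A)%N.
Proof. by case: A => //; rewrite /tvol big_nil ltxx. Qed.

Definition addbox p q : box := (p.1 + q.1, p.2 + q.2).

(** In each coordinate, split the point of the sum interval in proportion to
    the two lengths. *)
Lemma addboxP p q z : nondeg p -> nondeg q -> bset (addbox p q) z ->
  exists x y, [/\ bset p x, bset q y & z = x + y].
Proof.
move=> np nq hz.
pose r i : R := (z 0 i - (p.1 0 i + q.1 0 i)) / (side p i + side q i).
have r01 i : 0 <= r i < 1.
  have sp := side_nondeg_gt0 i np; have sq := side_nondeg_gt0 i nq.
  have s0 : 0 < side p i + side q i by rewrite addr_gt0.
  have := hz i; rewrite !mxE => /andP[h1 h2].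
  rewrite /r divr_ge0 ?(ltW s0) ?subr_ge0 //= ltr_pdivrMr // mul1r.
  by rewrite !nondeg_side //; lra.
exists (\row_i (p.1 0 i + r i * side p i)), (\row_i (q.1 0 i + r i * side q i)).
split.
- move=> i; rewrite mxE; have sp := side_nondeg_gt0 i np; have /andP[r0 r1] := r01 i.
  rewrite lerDl mulr_ge0 ?(ltW sp) //=.
  rewrite -ltrBrDl -nondeg_side // -[ltRHS]mul1r ltr_pM2r //.
- move=> i; rewrite mxE; have sp := side_nondeg_gt0 i nq; have /andP[r0 r1] := r01 i.
  rewrite lerDl mulr_ge0 ?(ltW sp) //=.
  rewrite -ltrBrDl -nondeg_side // -[ltRHS]mul1r ltr_pM2r //.
- apply/rowP => i; rewrite !mxE addrACA -mulrDr /r divfK.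
    by rewrite addrCA subrr addr0.
  by rewrite gt_eqF // addr_gt0 ?side_nondeg_gt0.
Qed.

End Boxes.

Section BrunnMinkowski.
Variables (R : realType) (d' : nat).
Let d := d'.+1.
Implicit Types (A B : seq (box R d)) (C : set 'rV[R]_d).

Lemma exists_root (a : R) : 0 <= a -> exists2 t, 0 <= t & t ^+ d = a.
Proof.
move=> a0; exists (a `^ d%:R^-1); first exact: powR_ge0.
by rewrite -powR_mulrn ?powR_ge0 // -powRrM mulVf ?pnatr_eq0 // powRr1.
Qed.

(** Divide by [\prod (a i + b i)] and apply the inequality between the
    arithmetic and geometric means to the ratios [a i / (a i + b i)] and to
    [b i / (a i + b i)]; the two means add up to [1]. *)
Lemma brunn_minkowski_prod (a b : 'I_d -> R) (s t : R) : (forall i, 0 < a i) ->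
  (forall i, 0 < b i) ->
  0 <= s -> 0 <= t -> s ^+ d <= \prod_i a i -> t ^+ d <= \prod_i b i ->
  (s + t) ^+ d <= \prod_i (a i + b i).
Proof.
move=> a0 b0 s0 t0 sa tb.
have ab0 i : 0 < a i + b i by rewrite addr_gt0.
have P0 : 0 <= \prod_i (a i + b i) by apply: prodr_ge0 => i _; exact: ltW.
have [p p0 pE] := exists_root P0.
have amgm (c : 'I_d -> R) (u : R) : (forall i, 0 <= c i) -> 0 <= u -> u ^+ d <=
  \prod_i c i ->
    u <= (\sum_i (c i / (a i + b i))) / d%:R * p.
  move=> c0 u0 uc.
  have q0 i : 0 <= c i / (a i + b i) by rewrite divr_ge0 // ltW.
  have := (leif_AGM (A := 'I_d) (fun i _ => q0 i)).1; rewrite card_ord => h.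
  rewrite -(@ler_pXn2r _ d) ?nnegrE //; last first.
    by rewrite mulr_ge0 // divr_ge0 ?ler0n // sumr_ge0.
  rewrite exprMn pE; apply: le_trans uc _.
  apply: le_trans (ler_wpM2r P0 h); rewrite prodf_div divfK //.
  by rewrite gt_eqF // prodr_gt0.
have hs := amgm a s (fun i => ltW (a0 i)) s0 sa.
have ht := amgm b t (fun i => ltW (b0 i)) t0 tb.
rewrite -pE ler_pXn2r ?nnegrE ?addr_ge0 //; apply: le_trans (lerD hs ht) _.
rewrite -mulrDl -mulrDl -big_split /=.
rewrite (eq_bigr (fun=> 1)); last by move=> i _; rewrite -mulrDl divff // gt_eqF.
by rewrite sumr_const card_ord divff ?mul1r // pnatr_eq0.
Qed.

(** The Brunn-Minkowski inequality for the unions of two families of boxes.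
    The numbers [s] and [t] stand for lower bounds of the [d]-th roots of the
    volumes, which avoids roots in the induction. *)
Definition bm_for A B := forall C (s t : R), bnd C ->
  (forall p q x y, p \in A -> q \in B -> bset p x -> bset q y -> C (x + y)) ->
  0 <= s -> 0 <= t -> s ^+ d <= tvol A -> t ^+ d <= tvol B -> (s + t) ^+ d <= vol C.

Definition packed A := all (@nondeg R d) A && pairwise (@sep R d) A.

Lemma packed_cut f A : shrinks f -> packed A -> packed (cut f A).
Proof. by move=> fs /andP[_ sA]; rewrite /packed all_nondeg_cut sep_cut. Qed.

Lemma bm_sym A B : bm_for A B -> bm_for B A.
Proof.
move=> h C s t bC ABC s0 t0 sA tB; rewrite addrC; apply: h => // p q x y pA qB px qy.
by rewrite addrC; apply: (ABC q p).
Qed.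

Lemma bm_single p q : nondeg p -> nondeg q -> bm_for [:: p] [:: q].
Proof.
move=> np nq C s t bC ABC s0 t0; rewrite /tvol !big_seq1 => sp tq.
apply: le_trans (_ : vol (bset (addbox p q)) <= _); last first.
  apply: vol_le => // z /(addboxP np nq)[x [y [px qy ->]]].
  by apply: ABC px qy; rewrite mem_head.
apply: le_trans (bvol_le_vol _).
have h : forall i, side (addbox p q) i = side p i + side q i.
  move=> i; rewrite (nondeg_side i np) (nondeg_side i nq) /side !mxE max_l //; first
    by ring.
  by have := forallP np i; have := forallP nq i; lra.
rewrite /bvol (eq_bigr _ (fun i _ => h i)); apply: brunn_minkowski_prod => // i;
  exact: side_nondeg_gt0.
Qed.

(** The volume below a hyperplane varies continuously from [0] to the total
    as the hyperplane moves. *)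
Lemma proportional_cut i (th : R) B : 0 <= th <= 1 -> all (@nondeg R d) B ->
  exists t, tvol (cut (below i t) B) = th * tvol B.
Proof.
move=> /andP[th0 th1] nB.
pose g t := \sum_(p <- B) bvol (below i t p).
pose M := \sum_(p <- B) (`|p.1 0 i| + `|p.2 0 i|).
have BM p : p \in B -> `|p.1 0 i| <= M /\ `|p.2 0 i| <= M.
  move=> pB; rewrite /M (big_rem p pB) /=.
  have h : 0 <= \sum_(y <- rem p B) (`|y.1 0 i| + `|y.2 0 i|).
    by apply: sumr_ge0 => y _; rewrite addr_ge0.
  have := normr_ge0 (p.1 0 i); have := normr_ge0 (p.2 0 i); split; lra.
have M0 : 0 <= M by apply: sumr_ge0 => p _; rewrite addr_ge0.
have gM0 : g (- M) = 0.
  rewrite /g big_seq big1 // => p /BM[h _]; apply: bvol_degenerate.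
  apply/forallPn; exists i; rewrite /= mxE eqxx -leNgt ge_min; apply/orP; right.
  by move: h; rewrite ler_norml => /andP[].
have gM1 : g M = tvol B.
  rewrite /g /tvol; apply: eq_big_seq => p /BM[_ h]; congr bvol.
  rewrite /below; case: p h => a b /= h; congr (_, _); apply/rowP => j.
  rewrite mxE; case: eqP => // ->; rewrite min_l //.
  by apply: le_trans h; exact: ler_norm.
have tB0 : 0 <= tvol B by apply: sumr_ge0 => p _; exact: bvol_ge0.
have [|||c _ gc] := @IVT R g (- M) M (th * tvol B); last first.
- by exists c; rewrite tvol_cut.
- rewrite gM0 gM1 min_l // max_r // mulr_ge0 //=.
  by rewrite -[leRHS]mul1r ler_wpM2r.
- apply: continuous_subspaceT => t; apply: cvg_big; first exact: add_continuous.
  by move=> p _; exact: bvol_below_continuous.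
- by rewrite ge0_cp.
Qed.

(** The Hadwiger-Ohmann step. Cut the first family by a hyperplane separating
    two of its boxes, so that both parts have fewer boxes, and the second family
    by a parallel hyperplane in the same volume ratio [th : 1 - th]. The sums of
    the corresponding parts lie on either side of the sum of the hyperplanes, and
    the inequality for the parts, scaled by [th] and [1 - th], adds up. *)
Lemma bm_step A B : packed A -> packed B -> (1 < size A)%N -> (0 < size B)%N ->
  (forall A' B', packed A' -> packed B' -> (0 < size A')%N -> (0 < size B')%N ->
     (size A' + size B' < size A + size B)%N -> bm_for A' B') ->
  bm_for A B.
Proof.
move=> pkA pkB szA szB IH C s t bC ABC s0 t0 sA tB.
have [i [c [p [q [pA qA pc qc]]]]] : exists i c p q, [/\ p \in A, q \in A,
    p.2 0 i <= c & c <= q.1 0 i].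
  case: A pkA szA {IH ABC sA} => [|p [|q A]] // /andP[_ /= /andP[/andP[/existsP[i pq]
    _] _]] _.
  case/orP: pq => h; [exists i, (p.2 0 i), p, q | exists i, (q.2 0 i), q, p];
    by rewrite !inE !eqxx ?orbT.
have [nA sepA] := andP pkA; have [nB _] := andP pkB.
have np := allP nA _ pA; have nq := allP nA _ qA.
set A1 := cut (below i c) A; set A2 := cut (above i c) A.
have szA1 : (size A1 < size A)%N.
  apply: (size_cut_lt qA); apply/forallPn; exists i; rewrite /= mxE eqxx -leNgt.
  by rewrite ge_min qc orbT.
have szA2 : (size A2 < size A)%N.
  apply: (size_cut_lt pA); apply/forallPn; exists i; rewrite /= mxE eqxx -leNgt.
  by rewrite le_max pc orbT.
have A1p : p \in A1.
  rewrite mem_filter np /=; apply/mapP; exists p => //.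
  rewrite /below; case: p {pA np} pc => a b /= pc; congr (_, _); apply/rowP => j.
  by rewrite mxE; case: eqP => // ->; rewrite min_l.
have A2q : q \in A2.
  rewrite mem_filter nq /=; apply/mapP; exists q => //.
  rewrite /above; case: q {qA nq} qc => a b /= qc; congr (_, _); apply/rowP => j.
  by rewrite mxE; case: eqP => // ->; rewrite max_l.
have vA1 := tvol_gt0 A1p np; have vA2 := tvol_gt0 A2q nq.
have vA := tvol_split i c A; rewrite -/A1 -/A2 in vA.
have vA0 : 0 < tvol A by rewrite vA addr_gt0.
pose th := tvol A1 / tvol A.
have thA1 : tvol A1 = th * tvol A by rewrite divfK // gt_eqF.
have thA2 : tvol A2 = (1 - th) * tvol A by rewrite mulrBl mul1r -thA1 vA addrC addKr.
have th0 : 0 < th by rewrite divr_gt0.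
have th1 : 0 < 1 - th by rewrite -(pmulr_lgt0 _ vA0) -thA2.
have vB0 : 0 < tvol B.
  by case: B szB nB {IH ABC tB pkB} => // b B _ /andP[nb _]; apply: (tvol_gt0 _ nb);
    rewrite mem_head.
have [|c' thB1] := @proportional_cut i th B _ nB.
  by rewrite (ltW th0) /= -subr_ge0 ltW.
set B1 := cut (below i c') B in thB1; pose B2 := cut (above i c') B.
have thB2 : tvol B2 = (1 - th) * tvol B.
  by have := tvol_split i c' B; rewrite -/B1 -/B2 mulrBl mul1r -thB1 => ->; rewrite
    addrC addKr.
have [u u0 uE] := exists_root (ltW th0).
have [w w0 wE] := exists_root (ltW th1).
pose C1 := C `&` [set x | x 0 i < c + c']; pose C2 := C `&` [set x | c + c' <= x 0 i].
have C12 : vol C1 + vol C2 <= vol C.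
  apply: vol_disjoint => //; [exact: subIsetl | exact: subIsetl |].
  by move=> x [[_ /= h1] [_ /= h2]]; move: h1; rewrite ltNge h2.
apply: le_trans C12.
have -> : (s + t) ^+ d = (u * s + u * t) ^+ d + (w * s + w * t) ^+ d.
  by rewrite -!mulrDr !exprMn uE wE -mulrDl addrCA subrr addr0 mul1r.
apply: lerD.
  apply: (IH A1 B1).
  - exact: packed_cut (below_shrinks i c) pkA.
  - exact: packed_cut (below_shrinks i c') pkB.
  - exact: tvol_gt0_size.
  - by apply: tvol_gt0_size; rewrite thB1 mulr_gt0.
  - by rewrite -addSn leq_add // size_cut.
  - exact: sub_bnd (@subIsetl _ _ _) bC.
  - move=> p' q' x y; rewrite !mem_filter => /andP[_ /mapP[p0 p0A ->]] /andP[_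
    /mapP[q0 q0B ->]].
    move=> /belowP[px xc] /belowP[qy yc]; split; first exact: ABC px qy.
    by rewrite /= mxE ltrD.
  - exact: mulr_ge0.
  - exact: mulr_ge0.
  - by rewrite exprMn uE thA1 ler_pM2l.
  - by rewrite exprMn uE thB1 ler_pM2l.
apply: (IH A2 B2).
- exact: packed_cut (above_shrinks i c) pkA.
- exact: packed_cut (above_shrinks i c') pkB.
- exact: tvol_gt0_size.
- by apply: tvol_gt0_size; rewrite thB2 mulr_gt0.
- by rewrite -addSn leq_add // size_cut.
- exact: sub_bnd (@subIsetl _ _ _) bC.
- move=> p' q' x y; rewrite !mem_filter => /andP[_ /mapP[p0 p0A ->]] /andP[_ /mapP[q0
  q0B ->]].
  move=> /aboveP[px xc] /aboveP[qy yc]; split; first exact: ABC px qy.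
  by rewrite /= mxE lerD.
- exact: mulr_ge0.
- exact: mulr_ge0.
- by rewrite exprMn wE thA2 ler_pM2l.
- by rewrite exprMn wE thB2 ler_pM2l.
Qed.

Theorem brunn_minkowski_boxes A B : packed A -> packed B -> (0 < size A)%N -> (0 <
  size B)%N ->
  bm_for A B.
Proof.
have [m] := ubnP (size A + size B).
elim: m A B => // m IH A B szm pkA pkB szA szB.
have IH' A' B' : packed A' -> packed B' -> (0 < size A')%N -> (0 < size B')%N ->
    (size A' + size B' < size A + size B)%N -> bm_for A' B'.
  by move=> ? ? ? ? h; apply: IH => //; apply: leq_trans h _; rewrite -ltnS.
have [A1|A1] := ltnP 1 (size A); first exact: bm_step.
have [B1|B1] := ltnP 1 (size B).
  apply: bm_sym; apply: bm_step => // A' B' *; apply: bm_sym; apply: IH' => //.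
  by rewrite addnC [X in (_ < X)%N]addnC.
case: A pkA szA A1 {IH' szm} => [|p [|? ?]] // /andP[/= /andP[np _] _] _ _.
case: B pkB szB B1 => [|q [|? ?]] // /andP[/= /andP[nq _] _] _ _.
exact: bm_single.
Qed.

End BrunnMinkowski.

(** * Convex bodies, homogeneity of the volume and the Brunn-Minkowski inequality *)

Section Bernoulli.
Variable R : realType.

Lemma bernoulli (e : R) n : 0 <= e <= 1 -> 1 - n%:R * e <= (1 - e) ^+ n.
Proof.
move=> /andP[e0 e1]; elim: n => [|n IH]; first by rewrite mul0r subr0 expr0.
rewrite exprS; apply: le_trans (ler_wpM2l _ IH); last by rewrite subr_ge0.
have : 0 <= n%:R * e * e by rewrite !mulr_ge0.
by rewrite -natr1; lra.
Qed.

(** The form in which all limits [e -> 0] are taken. *)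
Lemma le_of_shrink n (a b : R) : 0 <= a ->
  (forall e, 0 < e -> e < 1 -> (1 - e) ^+ n * a <= b) -> a <= b.
Proof.
move=> a0 h; rewrite leNgt; apply/negP => ba.
have b0 : 0 <= b.
  apply: le_trans (h 2^-1 _ _); rewrite ?mulr_ge0 ?exprn_ge0 ?invr_gt0 //; last lra.
  by lra.
have {}a0 : 0 < a by apply: le_lt_trans ba.
pose e := (a - b) / (2 * a * n.+1%:R).
have n0 : 0 < n.+1%:R :> R by rewrite ltr0n.
have D0 : 0 < 2 * a * n.+1%:R by rewrite !mulr_gt0.
have e0 : 0 < e by rewrite divr_gt0 // subr_gt0.
have e1 : e < 1.
  rewrite ltr_pdivrMr // mul1r.
  have : 2 * a * 1 <= 2 * a * n.+1%:R by rewrite ler_pM2l ?mulr_gt0 // ler1n.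
  by lra.
have := h e e0 e1; rewrite leNgt => /negP; apply.
have he : 0 <= e <= 1 by rewrite !ltW.
apply: lt_le_trans (ler_wpM2r (ltW a0) (bernoulli n he)).
rewrite mulrBl mul1r.
have : n%:R * e * a <= (a - b) / 2.
  rewrite (_ : (a - b) / 2 = n.+1%:R * e * a); last first.
    by rewrite /e; field; rewrite ?gt_eqF.
  by rewrite !ler_pM2r // ler_nat.
by lra.
Qed.
End Bernoulli.

Section Bodies.
Variables (R : realType) (d' : nat).
Let d := d'.+1.
Implicit Types (A B C K : set 'rV[R]_d) (x y z : 'rV[R]_d).

Definition cvx K := forall x y (t : R), K x -> K y -> 0 <= t <= 1 ->
  K (t *: x + (1 - t) *: y).
Definition has_cube (r : R) K := forall x, (forall i, `|x 0 i| <= r) -> K x.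
Definition body K := [/\ cvx K, bnd K & exists2 r, 0 < r & has_cube r K].

Lemma body_bnd K : body K -> bnd K. Proof. by case. Qed.

Lemma body0 K : body K -> K 0.
Proof. by case=> _ _ [r r0]; apply=> i; rewrite mxE normr0 ltW. Qed.

Lemma cvx_add K (a b : R) x y : cvx K -> 0 <= a -> 0 <= b -> K x -> K y ->
  exists2 z, K z & a *: x + b *: y = (a + b) *: z.
Proof.
move=> cK a0 b0 Kx Ky; have [ab0|ab0] := eqVneq (a + b) 0.
  have /eqP : a + b == 0 by rewrite ab0.
  move=> /eqP; rewrite paddr_eq0 // => /andP[/eqP -> /eqP ->].
  by exists x => //; rewrite addr0 !scale0r addr0.
have abp : 0 < a + b by rewrite lt_neqAle eq_sym ab0 addr_ge0.
exists ((a / (a + b)) *: x + (1 - a / (a + b)) *: y).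
  apply: cK => //; rewrite divr_ge0 ?addr_ge0 //= ler_pdivrMr // mul1r.
  by rewrite lerDl.
rewrite scalerDr !scalerA mulrCA divff // mulr1; congr (_ + _ *: _).
by field.
Qed.

Definition scl (s : R) K : set 'rV[R]_d := [set s *: x | x in K].
(** The set [a K - b K]. For convex [K] and nonnegative coefficients these sets
    are closed under Minkowski sums, and all the sets needed have this form. *)
Definition comb (a b : R) K : set 'rV[R]_d :=
  [set z | exists x y, [/\ K x, K y & z = a *: x - b *: y]].

Lemma scl1 K : scl 1 K = K.
Proof.
apply/seteqP; split => [_ [x Kx <-]|x Kx]; first by rewrite scale1r.
by exists x; rewrite ?scale1r.
Qed.

Lemma scl_scl s t K : scl s (scl t K) = scl (s * t) K.
Proof.
apply/seteqP; split => [_ [_ [x Kx <-] <-]|_ [x Kx <-]].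
  by exists x => //; rewrite scalerA.
by exists (t *: x); [exists x | rewrite scalerA].
Qed.

Lemma scl_comb s a b K : scl s (comb a b K) = comb (s * a) (s * b) K.
Proof.
apply/seteqP; split => [_ [_ [x [y [Kx Ky ->]]] <-]|_ [x [y [Kx Ky ->]]]].
  by exists x, y; rewrite scalerBr !scalerA.
by exists (a *: x - b *: y); [exists x, y | rewrite scalerBr !scalerA].
Qed.

Lemma scl_bnd s K : bnd K -> bnd (scl s K).
Proof.
move=> [M KM]; exists (`|s| * M) => _ [x Kx <-] i.
by rewrite mxE normrM ler_wpM2l // KM.
Qed.

Lemma comb_bnd a b K : bnd K -> bnd (comb a b K).
Proof.
move=> [M KM]; exists (`|a| * M + `|b| * M) => _ [x [y [Kx Ky ->]]] i.
rewrite !mxE; apply: le_trans (ler_normB _ _) _; rewrite !normrM.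
by rewrite lerD // ler_wpM2l // KM.
Qed.

Lemma scl_cube s r K : 0 < s -> has_cube r K -> has_cube (s * r) (scl s K).
Proof.
move=> s0 Kr x xr; exists (s^-1 *: x); last first.
  by rewrite scalerA divff ?scale1r // gt_eqF.
apply: Kr => i; rewrite mxE normrM normfV (gtr0_norm s0) ler_pdivrMl //.
Qed.

Lemma body_scl s K : 0 < s -> body K -> body (scl s K).
Proof.
move=> s0 [cK bK [r r0 Kr]]; split; last 2 first.
- exact: scl_bnd.
- by exists (s * r); [exact: mulr_gt0 | exact: scl_cube].
move=> _ _ t [x Kx <-] [y Ky <-] t01; exists (t *: x + (1 - t) *: y).
  exact: cK.
by rewrite scalerDr !scalerA ![s * _]mulrC.
Qed.

Lemma body_comb a b K : 0 < a -> body K -> body (comb a b K).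
Proof.
move=> a0 bK; have K0 := body0 bK; have [cK bdK [r r0 Kr]] := bK; split; last 2 first.
- exact: comb_bnd.
- exists (a * r); first exact: mulr_gt0.
  move=> x /(scl_cube a0 Kr)[y Ky <-]; exists y, 0.
  by rewrite scaler0 subr0.
move=> _ _ t [x [y [Kx Ky ->]]] [x' [y' [Kx' Ky' ->]]] t01.
exists (t *: x + (1 - t) *: x'), (t *: y + (1 - t) *: y').
split; [exact: cK | exact: cK |].
rewrite !scalerBr !scalerDr !scalerA ![a * _]mulrC ![b * _]mulrC.
by rewrite addrACA -opprD.
Qed.

Lemma combD K a b a' b' x y : cvx K -> 0 <= a -> 0 <= b -> 0 <= a' -> 0 <= b' ->
  comb a b K x -> comb a' b' K y -> comb (a + a') (b + b') K (x + y).
Proof.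
move=> cK a0 b0 a0' b0' [p [q [Kp Kq ->]]] [p' [q' [Kp' Kq' ->]]].
have [z Kz zE] := cvx_add cK a0 a0' Kp Kp'.
have [w Kw wE] := cvx_add cK b0 b0' Kq Kq'.
by exists z, w; split => //; rewrite -zE -wE addrACA opprD.
Qed.

Lemma combN K a b x : comb a b K x -> comb b a K (- x).
Proof. by move=> [p [q [Kp Kq ->]]]; exists q, p; rewrite opprB. Qed.

Lemma sub_comb K a b a' b' : cvx K -> K 0 -> 0 <= a <= a' -> 0 <= b <= b' ->
  comb a b K `<=` comb a' b' K.
Proof.
move=> cK K0 /andP[a0 aa'] /andP[b0 bb'] x xab.
have z0 : comb (a' - a) (b' - b) K 0 by exists 0, 0; rewrite !scaler0 subr0.
have := combD cK a0 b0 _ _ xab z0.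
by rewrite addr0 addrCA subrr addr0 addrCA subrr addr0; apply; rewrite subr_ge0.
Qed.

Lemma comb_pos K a : K 0 -> comb a 0 K = scl a K.
Proof.
move=> K0; apply/seteqP; split => [_ [x [y [Kx _ ->]]]|_ [x Kx <-]].
  by exists x => //; rewrite scale0r subr0.
by exists x, 0; rewrite scale0r subr0.
Qed.

Lemma tvol_le_vol (A : seq (box R d)) C : pairwise (@sep R d) A -> bnd C ->
  (forall p, p \in A -> bset p `<=` C) -> tvol A <= vol C.
Proof.
elim: A C => [|p A IH] C /=; first by move=> _ bC _; rewrite /tvol big_nil vol_ge0.
move=> /andP[/allP pA sA] bC AC'.
have pC : bset p `<=` C by apply: AC'; rewrite mem_head.
pose C' := C `\` bset p.
have bC' : bnd C' by apply: sub_bnd bC; exact: subDsetl.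
rewrite /tvol big_cons.
apply: le_trans (lerD (bvol_le_vol p) (IH C' sA bC' _)) _; last first.
  apply: vol_disjoint => //; first exact: subDsetl.
  by move=> x [px [_]].
move=> q qA x qx; split; first by apply: (AC' q) qx; rewrite inE qA orbT.
move=> px; have /existsP[i] := pA q qA.
have := px i; have := qx i => /andP[h1 h2] /andP[h3 h4].
case/orP => h5.
  by have := lt_le_trans h4 (le_trans h5 h1); rewrite ltxx.
by have := lt_le_trans h2 (le_trans h5 h3); rewrite ltxx.
Qed.

(** Corners are taken in [(1 - e) K] so that, on a fine enough grid, whole cubes
    lie in [K]; their total volume is then a point count ([tvol_cubes]). *)
Definition cubes n (s e : R) K : seq (box R d) :=
  [seq (s *: grid_pt R n u, s *: (grid_pt R n u + const_mx n.+1%:R^-1)) | u <- pts n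
    (scl (1 - e) K)].

Lemma packed_cubes n s e K : 0 < s -> packed (cubes n s e K).
Proof.
move=> s0; have n0 : 0 < n.+1%:R^-1 :> R by rewrite invr_gt0 ltr0n.
apply/andP; split.
  apply/allP => _ /mapP[u _ ->]; apply/forallP => i /=; rewrite !mxE.
  by rewrite ltr_pM2l // ltrDl.
rewrite pairwise_map; apply: (@sub_in_pairwise _ predT (fun u v => u != v)).
  move=> u v _ _ uv /=.
  have [i ui] : exists i, u 0 i != v 0 i.
    apply/existsP; apply: contraR uv; rewrite negb_exists => /forallP h.
    by apply/eqP/rowP => i; have := h i; rewrite negbK => /eqP.
  apply/existsP; exists i; rewrite /= !mxE.
  have gapE (a b : int) :
      (a%:~R / n.+1%:R + n.+1%:R^-1 <= b%:~R / n.+1%:R :> R) = (a + 1 <= b).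
    by rewrite -[X in _ + X]mul1r -mulrDl ler_pM2r // -[1]/(1%:~R) -intrD ler_int.
  rewrite !ler_pM2l // !gapE.
  by move: (u 0 i) (v 0 i) ui => a b; lia.
  by apply/allP.
by rewrite -uniq_pairwise pts_uniq.
Qed.

Lemma tvol_cubes n s e K : 0 <= s -> tvol (cubes n s e K) = s ^+ d * dens (scl (1 -
  e) K) n.
Proof.
move=> s0; have n0 : 0 < n.+1%:R^-1 :> R by rewrite invr_gt0 ltr0n.
rewrite /tvol big_map (eq_bigr (fun=> (s / n.+1%:R) ^+ d)); last first.
  move=> u _; rewrite /bvol /side /= (eq_bigr (fun=> s / n.+1%:R)) ?prodr_const
    ?card_ord //.
  move=> i _; rewrite !mxE mulrDr addrAC subrr add0r max_l //.
  by rewrite mulr_ge0 // ltW.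
rewrite big_const_seq count_predT iter_addr_0 -/(cnt _ _) /dens -[LHS]mulr_natl.
by rewrite exprMn exprVn mulrCA.
Qed.

Lemma cubes_sub n s e r K : cvx K -> has_cube r K -> 0 < s -> 0 < e -> e < 1 -> bnd K ->
  n.+1%:R^-1 <= e * r -> forall p, p \in cubes n s e K -> bset p `<=` scl s K.
Proof.
move=> cK Kr s0 e0 e1 bK hn _ /mapP[u up ->] x /= px.
have [k Kk kE] : scl (1 - e) K (grid_pt R n u) by apply/mem_ptsP: up; exact: scl_bnd.
exists (s^-1 *: x); last by rewrite scalerA divff ?scale1r // gt_eqF.
pose w := s^-1 *: x - grid_pt R n u.
have wr i : `|(e^-1 *: w) 0 i| <= r.
  have /andP[] := px i; rewrite !mxE -/(grid_pt R n u) => h1 h2.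
  rewrite normrM normfV (gtr0_norm e0) ler_pdivrMl //; apply: le_trans hn.
  rewrite ger0_norm; last by rewrite subr_ge0 ler_pdivlMl.
  by rewrite lerBlDl ler_pdivrMl // ltW.
have -> : s^-1 *: x = e *: (e^-1 *: w) + (1 - e) *: k.
  by rewrite kE scalerA divff ?gt_eqF // scale1r subrK.
by apply: cK => //; [exact: Kr | rewrite !ltW].
Qed.

Lemma near_small (c : R) : 0 < c -> \forall n \near ufil, n.+1%:R^-1 <= c.
Proof.
move=> c0; apply: oo_ufil; have := @cvg_harmonic R => /cvgr0Pnorm_le /(_ c c0).
by apply: filterS => n /=; rewrite ger0_norm.
Qed.

(** The cubes inside [K], scaled by [s], are disjoint boxes inside [s K]. *)
Lemma vol_scl_ge s e K : body K -> 0 < s -> 0 < e -> e < 1 ->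
  s ^+ d * vol (scl (1 - e) K) <= vol (scl s K).
Proof.
move=> bK s0 e0 e1; have [cK bdK [r r0 Kr]] := bK.
apply: ler_cvg_to (cvgM (cvg_cst (s ^+ d)) (cvg_dens (scl_bnd (1 - e) bdK))) (cvg_cst
  (vol (scl s K))) _.
have := near_small (mulr_gt0 e0 r0); apply: filterS => n hn.
have := tvol_cubes n e K (ltW s0); rewrite /= => <-; apply: tvol_le_vol.
- by case/andP: (packed_cubes n e K s0).
- exact: scl_bnd.
- exact: cubes_sub hn.
Qed.

(** [vol_scl_ge], applied to all pairs of scales with [e] tending to [0], says
    that [vol (x K) / x^d] is at least [vol (y K) / y^d] for all [x, y > 0]. *)
Lemma vol_homogeneous s K : body K -> 0 < s -> vol (scl s K) = s ^+ d * vol K.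
Proof.
move=> bK s0.
have key (x y : R) : 0 < x -> 0 < y -> x ^+ d * vol (scl y K) <= y ^+ d * vol (scl x K).
  move=> x0 y0; apply: (@le_of_shrink _ d); first by rewrite mulr_ge0 ?exprn_ge0
    ?(ltW x0) ?vol_ge0 //; exact: scl_bnd (body_bnd bK).
  move=> e e0 e1; have e1' : 0 < 1 - e by rewrite subr_gt0.
  have := @vol_scl_ge (x * (1 - e) / y) e (scl (y / (1 - e)) K) _ _ e0 e1.
  have E1 : (1 - e) * (y / (1 - e)) = y by field; rewrite gt_eqF.
  have E2 : x * (1 - e) / y * (y / (1 - e)) = x by field; rewrite !gt_eqF.
  rewrite !scl_scl E1 E2.
  move=> /(_ (body_scl _ bK)) h.
  have := h (divr_gt0 y0 e1') (divr_gt0 (mulr_gt0 x0 e1') y0).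
  rewrite -(ler_pM2l (exprn_gt0 d y0)) mulrA -exprMn [y * _]mulrC divfK ?gt_eqF //.
  by rewrite exprMn [_ ^+ _ * _ ^+ _]mulrC -mulrA.
apply/le_anti/andP; split.
  by have := key 1 s ltr01 s0; rewrite expr1n mul1r scl1.
by have := key s 1 s0 ltr01; rewrite expr1n mul1r scl1.
Qed.

Lemma vol_gt0 K : body K -> 0 < vol K.
Proof.
move=> [_ bK [r r0 Kr]]; pose p : box R d := (0, const_mx r).
have np : nondeg p by apply/forallP => i; rewrite /= !mxE.
apply: lt_le_trans (bvol_gt0 np) _; apply: le_trans (bvol_le_vol p) _.
apply: vol_le => // x px; apply: Kr => i; have := px i; rewrite !mxE => /andP[x0 xr].
by rewrite ger0_norm // ltW.
Qed.

(** Each body contains a family of grid cubes of almost the same volume. *)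
Lemma brunn_minkowski A B C (s t : R) : body A -> body B -> bnd C ->
  (forall x y, A x -> B y -> C (x + y)) -> 0 <= s -> 0 <= t ->
  s ^+ d <= vol A -> t ^+ d <= vol B -> (s + t) ^+ d <= vol C.
Proof.
move=> bA bB bC ABC s0 t0 sA tB.
apply: (@le_of_shrink _ (d + d)); first by rewrite exprn_ge0 ?addr_ge0.
move=> e e0 e1; have e1' : 0 < 1 - e by rewrite subr_gt0.
have near_tvol K u : body K -> 0 <= u -> u ^+ d <= vol K ->
    \forall n \near ufil, [/\ ((1 - e) ^+ 2 * u) ^+ d <= tvol (cubes n 1 e K), (0 <
      size (cubes n 1 e K))%N &
    (forall p, p \in cubes n 1 e K -> bset p `<=` K)].
  move=> bK u0 uK; have [cK bdK [r r0 Kr]] := bK.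
  have c : dens (scl (1 - e) K) @ ufil --> (1 - e) ^+ d * vol K.
    by rewrite -vol_homogeneous //; apply: cvg_dens; exact: scl_bnd.
  have lt1 : ((1 - e) ^+ 2 * u) ^+ d < (1 - e) ^+ d * vol K.
    rewrite exprMn -exprM mulnC exprM expr2 -mulrA ltr_pM2l ?exprn_gt0 //.
    apply: le_lt_trans (_ : (1 - e) ^+ d * vol K < _).
      by rewrite ler_pM2l ?exprn_gt0.
    rewrite -[ltRHS]mul1r ltr_pM2r ?vol_gt0 // exprn_ilt1 //; first exact: ltW.
    by rewrite ltrBlDr ltrDl.
  have h1 := cvgr_ge _ c _ lt1; have h2 := near_small (mulr_gt0 e0 r0).
  have h3 : 0 < (1 - e) ^+ d * vol K by rewrite mulr_gt0 ?exprn_gt0 ?vol_gt0.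
  have h4 := cvgr_gt _ c _ h3.
  near=> n; split; rewrite ?tvol_cubes // ?expr1n ?mul1r.
  - by near: n; exact: h1.
  - by apply: tvol_gt0_size; rewrite tvol_cubes // expr1n mul1r; near: n; exact: h4.
  - rewrite -{2}[K]scl1; apply: cubes_sub cK Kr _ e0 e1 bdK _ => //.
    by near: n; exact: h2.
have [n [[hA zA cA] [hB zB cB]]] := filter_ex (filterI (near_tvol A s bA s0 sA)
  (near_tvol B t bB t0 tB)).
have e20 : 0 <= (1 - e) ^+ 2 by rewrite exprn_ge0 // ltW.
have -> : (1 - e) ^+ (d + d) * (s + t) ^+ d = ((1 - e) ^+ 2 * s + (1 - e) ^+ 2 * t)
  ^+ d.
  by rewrite -mulrDr exprMn -exprM addnn -mul2n.
apply: (brunn_minkowski_boxes (packed_cubes n e A ltr01) (packed_cubes n e B ltr01)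
  zA zB) => //.
- by move=> p q x y pA qB px qy; apply: ABC; [exact: cA px | exact: cB qy].
- exact: mulr_ge0.
- exact: mulr_ge0.
Unshelve. all: by end_near.
Qed.
End Bodies.

(** * The Rogers-Shephard inequality *)

Section BetaSum.

Lemma ffactS n k : (n.+1 ^_ k.+1 = n ^_ k.+1 + k.+1 * n ^_ k)%N.
Proof.
rewrite ffactSS ffactnSr; have [kn|kn] := leqP k n; last first.
  by rewrite ffact_small // muln0 mul0n muln0.
by rewrite [X in (_ + X)%N]mulnC -mulnDr mulnC; congr muln; lia.
Qed.

Lemma sum_bin_bin a b N :
  (\sum_(i < N.+1) 'C(i, a) * 'C(N - i, b) = 'C(N.+1, (a + b).+1))%N.
Proof.
elim: N b => [|N IH] b.
  rewrite big_ord1 subnn !bin0n; case: a => [|a]; case: b => [|b] //.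
rewrite big_ord_recr /= subnn; case: b => [|b].
  rewrite bin0 muln1 addn0 binS; congr addn; rewrite -[in RHS](addn0 a) -IH.
  by apply: eq_bigr => i _; rewrite !bin0.
rewrite bin0n muln0 addn0 binS addnS -IH -addnS -IH -big_split /=.
by apply: eq_bigr => i _; rewrite -mulnDr subSn ?binS // -ltnS.
Qed.

Lemma sum_ffact_ffact a b m :
  (\sum_(j < m) j.+1 ^_ a.+1 * (m - j.+1) ^_ b =
   a.+1`! * b`! * 'C(m.+1, (a.+1 + b).+1))%N.
Proof.
rewrite -sum_bin_bin big_ord_recl bin0n mul0n add0n big_distrr /=.
by apply: eq_bigr => j _; rewrite -!bin_ffact /bump /= add1n mulnACA mulnC.
Qed.

Lemma ffact_le_exp n k : (n ^_ k <= n ^ k)%N.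
Proof.
elim: k => // k IH; rewrite ffactnSr expnSr leq_mul //; exact: leq_subr.
Qed.

Lemma ffact_ge_exp n k : ((n - k) ^ k <= n ^_ k)%N.
Proof.
elim: k => // k IH; rewrite ffactnSr expnSr leq_mul ?leq_sub2l //.
by apply: leq_trans IH; case: k => // k; rewrite leq_exp2r // leq_sub2l.
Qed.

Variables (R : realFieldType) (d' : nat).
Let d := d'.+1.

Lemma abel_sum (a b : nat -> R) m : a 0%N = 0 -> b m = 0 ->
  \sum_(j < m) (a j.+1 - a j) * b j = \sum_(j < m) a j.+1 * (b j - b j.+1).
Proof.
move=> a0 bm; apply/eqP; rewrite -subr_eq0 -sumrB; apply/eqP.
rewrite (eq_bigr (fun j : 'I_m => a j.+1 * b j.+1 - a j * b j)); last by move=> j _;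
  ring.
by rewrite -(big_mkord xpredT (fun j => a j.+1 * b j.+1 - a j * b j)) telescope_sumr
  // a0 bm; ring.
Qed.

(** A discrete form of [B(d, d + 1) d = 1 / C(2d,d)]: after replacing powers by
    falling factorials and summing by parts, the sum becomes a convolution of
    binomial coefficients. *)
Lemma beta_sum_ge m :
  (d`! ^ 2 * 'C(m.+1, 2 * d))%:R <=
  \sum_(j < m) (j.+1%:R ^+ d - j%:R ^+ d) * (m - j)%:R ^+ d :> R.
Proof.
pose a j : R := j%:R ^+ d; pose b j : R := ((m - j) ^_ d)%:R.
apply: le_trans (_ : \sum_(j < m) (a j.+1 - a j) * b j <= _); last first.
  apply: ler_sum => j _; apply: ler_wpM2l.
    by rewrite subr_ge0 lerXn2r ?nnegrE ?ler0n // ler_nat.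
  by rewrite /b -natrX ler_nat ffact_le_exp.
rewrite abel_sum /a ?expr0n // /b ?subnn //.
apply: le_trans (_ : \sum_(j < m) (j.+1 ^_ d * (d * (m - j.+1) ^_ d'))%:R <= _).
  rewrite -natr_sum (eq_bigr (fun j : 'I_m => d * (j.+1 ^_ d * (m - j.+1) ^_ d'))%N);
    last first.
    by move=> j _; rewrite mulnCA.
  rewrite -big_distrr /= sum_ffact_ffact ler_nat.
  have -> : (2 * d = (d'.+1 + d').+1)%N by rewrite /d; lia.
  rewrite mulnA leq_mul2r; apply/orP; right.
  by rewrite /d factS -mulnn; lia.
apply: ler_sum => j _; rewrite natrM ler_pM //.
  by rewrite -natrX ler_nat ffact_le_exp.
have -> : (m - j = (m - j.+1).+1)%N by rewrite subnSK.
by rewrite ffactS natrD addrAC subrr add0r.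
Qed.

End BetaSum.

Section RogersShephard.
Variables (R : realType) (d' : nat).
Let d := d'.+1.
Implicit Types (A B C K : set 'rV[R]_d) (x y z : 'rV[R]_d).

(** If [x = (1 - s)(a - b)] with [a, b] in [K], then [K] and [x + K] both
    contain [(1 - s) a + s K]; this is the only geometric input of the
    Rogers-Shephard inequality. *)
Lemma hits_ge_cnt n s e r K u : cvx K -> bnd K -> has_cube r K -> 0 < s -> s <= 1 ->
  0 < e -> e <= 1 -> n.+1%:R^-1 <= s * e * r -> comb (1 - s) (1 - s) K (grid_pt R n
    u) ->
  (cnt n (scl (s * (1 - e)) K) <= hits (pts n K) (pts n K) u)%N.
Proof.
move=> cK bK Kr s0 s1 e0 e1 hn [a [b [Ka Kb uE]]].
have se0 : 0 < s * e by rewrite mulr_gt0.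
have [g hg] := near_grid_pt n ((1 - s) *: a).
rewrite /cnt -(size_map (fun v => v + g)) /hits -size_filter; apply: uniq_leq_size.
  by rewrite map_inj_uniq ?pts_uniq //; exact: addIr.
move=> _ /mapP[v /mem_ptsP vK ->].
have [k Kk kE] := vK (scl_bnd _ bK).
(* the rounding error of the translation is absorbed by the factor 1 - e *)
have [w Kw wE] : exists2 w, K w & grid_pt R n (v + g) - (1 - s) *: a = s *: w.
  have Kc : K ((s * e)^-1 *: (grid_pt R n g - (1 - s) *: a)).
    apply: Kr => i; rewrite mxE normrM normfV (gtr0_norm se0) ler_pdivrMl //.
    apply: le_trans hn; apply: le_trans (hg i).
    by rewrite !mxE distrC.
  have e1' : 0 <= 1 - e by rewrite subr_ge0.
  have [w Kw wE] := cvx_add cK e1' (ltW e0) Kk Kc.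
  exists w => //; rewrite subrK scale1r in wE.
  rewrite -wE scalerDr !scalerA mulfV ?gt_eqF // scale1r kE grid_ptD.
  by rewrite addrA.
have inK p : K p -> K ((1 - s) *: p + s *: w).
  by move=> Kp; rewrite addrC; apply: cK => //; rewrite (ltW s0).
have vgE : grid_pt R n (v + g) = (1 - s) *: a + s *: w by rewrite -wE addrCA subrr
  addr0.
rewrite mem_filter; apply/andP; split; apply/mem_ptsP => //.
  have subE (x y z : 'rV[R]_d) : x + y - (x - z) = z + y.
    by rewrite opprB [z - x]addrC addrACA subrr add0r addrC.
  by rewrite grid_ptB vgE uE subE; exact: inK.
by rewrite vgE; exact: inK.
Qed.

(** The selected increments telescope to at most [c] at the last selected
    index. *)
Lemma sum_select_le (g : nat -> bool) (c : nat -> R) F m : c 0%N = 0 -> 0 <= F ->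
  (forall j, c j <= c j.+1) -> (forall j, (j < m)%N -> g j -> c j.+1 <= F) ->
  \sum_(j < m) (if g j then c j.+1 - c j else 0) <= F.
Proof.
move=> c0 F0 cm gF.
suff [] : \sum_(j < m) (if g j then c j.+1 - c j else 0) <= F /\
          \sum_(j < m) (if g j then c j.+1 - c j else 0) <= c m by [].
elim: m gF => [|m IH] gF; first by rewrite big_ord0 c0.
have [h1 h2] := IH (fun j jm => gF j (ltnW jm)).
rewrite big_ord_recr /=; case: ifP => gm; last first.
  by rewrite addr0; split => //; exact: le_trans (cm m).
have h3 : \sum_(i < m) (if g i then c i.+1 - c i else 0) + (c m.+1 - c m) <= c m.+1.
  by rewrite addrC -lerBrDl opprB addrC subrK.
by split => //; apply: le_trans h3 _; exact: gF.
Qed.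

Definition level m j : R := j%:R / m.+1%:R.

(** The value at [j = 0] is set to [0] because the degenerate body [0 K] still
    contains a grid point. *)
Definition shell_cnt n m e K (j : nat) : R :=
  if j is 0 then 0 else (cnt n (scl (level m j * (1 - e)) K))%:R.

(** Count the pairs of grid points of [K] by their difference [x], and bound
    the number of pairs with difference [x] by the largest level [s] for which
    [x] lies in [(1 - s)(K - K)], written as a sum over the levels below it. *)
Lemma rs_level n m e r K : cvx K -> bnd K -> has_cube r K -> 0 <= r ->
  0 < e -> e < 1 -> n.+1%:R^-1 <= m.+1%:R^-1 * e * r ->
  \sum_(j < m) (shell_cnt n m e K j.+1 - shell_cnt n m e K j)
      * (cnt n (scl (1 - level m j.+1) (comb 1 1 K)))%:R
  <= (cnt n K)%:R ^+ 2 :> R.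
Proof.
move=> cK bK Kr r0 e0 e1 hn.
have K0 : K 0 by apply: Kr => i; rewrite mxE normr0.
have m0 : 0 < m.+1%:R :> R by rewrite ltr0n.
set c := shell_cnt n m e K.
set D := comb 1 1 K.
have bD : bnd D by exact: comb_bnd.
have lev01 j : (j < m)%N -> 0 < level m j.+1 /\ level m j.+1 < 1.
  by move=> jm; rewrite divr_gt0 ?ltr0n // ltr_pdivrMr // mul1r ltr_nat.
have cm j : c j <= c j.+1.
  case: j => [|j]; rewrite /c /shell_cnt //= ler_nat cnt_mono //; first exact: scl_bnd.
  rewrite -!comb_pos //; apply: sub_comb => //; last by rewrite lexx.
  rewrite !mulr_ge0 ?divr_ge0 ?ler0n ?subr_ge0 ?(ltW e1) //=.
  by rewrite ler_wpM2r ?subr_ge0 ?(ltW e1) // ler_wpM2r ?invr_ge0 ?ler0n // ler_nat.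
have step (u : 'rV[int]_d) :
    \sum_(j < m) (if u \in pts n (scl (1 - level m j.+1) D) then c j.+1 - c j else 0)
    <= (hits (pts n K) (pts n K) u)%:R.
  apply: (sum_select_le (g := fun j => u \in pts n (scl (1 - level m j.+1) D))) => //
    j jm.
  have [l0 l1] := lev01 j jm.
  move=> /mem_ptsP -/(_ (scl_bnd _ bD)) uD.
  rewrite ler_nat; apply: (hits_ge_cnt (r := r)) => //; [exact: ltW l1 | exact: ltW
    e1 | |].
    apply: le_trans hn _; rewrite ler_wpM2r // ler_wpM2r ?(ltW e0) //.
    by rewrite -[leLHS]mul1r ler_wpM2r ?invr_ge0 ?ler0n // ler1n.
  by move: uD; rewrite scl_comb mulr1.
rewrite expr2 -natrM; apply: le_trans (_ : (\sum_(u <- pts n D) hits (pts n K) (pts n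
  K) u)%:R <= _); last first.
  by rewrite ler_nat sum_hits_le // pts_uniq.
rewrite natr_sum; apply: le_trans (ler_sum _ (fun u _ => step u)).
rewrite exchange_big /=; apply: ler_sum => j _; have [l0 l1] := lev01 j (ltn_ord j).
rewrite -big_mkcond /= big_const_seq iter_addr_0 -[leRHS]mulr_natr.
apply: ler_wpM2l; rewrite ?subr_ge0 ?cm //.
rewrite ler_nat -size_filter; apply: uniq_leq_size; first exact: pts_uniq.
move=> u uD; rewrite mem_filter uD /=; apply/mem_ptsP => //.
move/mem_ptsP: uD => /(_ (scl_bnd _ bD)); rewrite -[in X in _ -> X](scl1 D) !scl_comb
  !mulr1.
by apply: sub_comb => //; rewrite subr_ge0 (ltW l1) lerBlDr lerDl ltW.
Qed.

Lemma rs_limit m e K : body K -> 0 < e -> e < 1 ->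
  (1 - e) ^+ d * (\sum_(j < m) (j.+1%:R ^+ d - j%:R ^+ d) * (m - j)%:R ^+ d) * vol
    (comb 1 1 K)
  <= m.+1%:R ^+ (2 * d) * vol K.
Proof.
move=> bK e0 e1; have [cK bdK [r r0 Kr]] := bK.
have m0 : 0 < m.+1%:R :> R by rewrite ltr0n.
have bD : body (comb 1 1 K) by exact: body_comb.
have vK := vol_gt0 bK.
pose c n (j : nat) : R := if j is 0 then 0 else dens (scl (level m j * (1 - e)) K) n.
have cE (j : nat) : c n j @[n --> ufil] --> (j%:R / m.+1%:R * (1 - e)) ^+ d * vol K.
  case: j => [|j]; first by rewrite !mul0r expr0n mul0r; exact: cvg_cst.
  rewrite -vol_homogeneous //; last by rewrite mulr_gt0 ?subr_gt0 ?divr_gt0 ?ltr0n.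
  by apply: cvg_dens; exact: scl_bnd.
pose F n := \sum_(j < m) (c n j.+1 - c n j) * dens (scl (1 - level m j.+1) (comb 1 1
  K)) n.
have FE : F n @[n --> ufil] --> \sum_(j < m)
    ((j.+1%:R / m.+1%:R * (1 - e)) ^+ d * vol K - (j%:R / m.+1%:R * (1 - e)) ^+ d *
      vol K)
    * ((1 - level m j.+1) ^+ d * vol (comb 1 1 K)).
  apply: cvg_big => [|j _]; first exact: add_continuous.
  apply: cvgM; first by apply: cvgB; exact: cE.
  rewrite -vol_homogeneous //; first by apply: cvg_dens; apply: scl_bnd; exact:
    comb_bnd.
  by rewrite subr_gt0 ltr_pdivrMr // mul1r ltr_nat ltnS.
have le : \forall n \near ufil, F n <= dens K n ^+ 2.
  have h0 : 0 < m.+1%:R^-1 * e * r by rewrite !mulr_gt0 ?invr_gt0.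
  apply: filterS (near_small h0) => n hn.
  have N0 : 0 < n.+1%:R ^+ d :> R by rewrite exprn_gt0 ?ltr0n.
  have := rs_level cK bdK Kr (ltW r0) e0 e1 hn.
  rewrite -(@ler_pM2r _ ((n.+1%:R ^+ d)^-1 ^+ 2)) ?exprn_gt0 ?invr_gt0 // -exprMn.
  apply: le_trans; rewrite mulr_suml; apply: ler_sum => j _.
  have shellE i : c n i = shell_cnt n m e K i / n.+1%:R ^+ d.
    by case: i => [|i]; rewrite /c /shell_cnt /dens ?mul0r.
  by rewrite expr2 mulrACA !shellE -mulrBl.
have := ler_cvg_to FE (cvgM (cvg_dens bdK) (cvg_dens bdK)) le.
rewrite (_ : \sum_(j < m) _ = (1 - e) ^+ d * (\sum_(j < m) (j.+1%:R ^+ d - j%:R ^+ d)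
  * (m - j)%:R ^+ d)
  * vol (comb 1 1 K) / m.+1%:R ^+ (2 * d) * vol K); last first.
  rewrite mulr_sumr !mulr_suml; apply: eq_bigr => j _.
  rewrite (_ : 1 - level m j.+1 = (m - j)%:R / m.+1%:R); last first.
    by rewrite /level -subSS natrB ?ltnS 1?ltnW // mulrBl divff ?gt_eqF.
  rewrite !exprMn mul2n -addnn exprD !exprVn; field.
  by rewrite gt_eqF ?exprn_gt0.
rewrite ler_pM2r // ler_pdivrMr ?exprn_gt0 // [vol K * _]mulrC. exact.
Qed.

(** The levels [j / (m + 1)] of [rs_limit] give a Riemann sum of the integral
    of [d s^(d-1) (1 - s)^d]; let [m] tend to infinity and [e] to [0]. *)
Theorem rogers_shephard K : body K -> vol (comb 1 1 K) <= 'C(2 * d, d)%:R * vol K.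
Proof.
move=> bK; have bD : body (comb 1 1 K) by exact: body_comb.
have D0 := vol_gt0 bD; have vK := vol_gt0 bK.
apply: (@le_of_shrink _ (d + 2 * d)); first exact: ltW.
move=> e e0 e1; have e1' : 0 < 1 - e by rewrite subr_gt0.
have [m mE] : exists m, (2 * d)%:R <= e * m.+1%:R.
  exists (Num.truncn ((2 * d)%:R / e)); rewrite mulrC -ler_pdivrMr //.
  have q0 : 0 <= (2 * d)%:R / e by rewrite divr_ge0 // ltW.
  by have /andP[_ /ltW] := truncn_itv q0.
have m0 : 0 < m.+1%:R :> R by rewrite ltr0n.
have h1 := rs_limit m bK e0 e1.
have h2 := beta_sum_ge R d' m; rewrite -/d in h2.
have f0 : (0 < d`!)%N by exact: fact_gt0.
have CE : ('C(2 * d, d) * (d`! * d`!) = (2 * d)`!)%N.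
  by rewrite -(@bin_fact (2 * d) d) ?mul2n -?addnn ?addnK // leq_addr.
have h3 : ((1 - e) * m.+1%:R) ^+ (2 * d) <= 'C(2 * d, d)%:R * (d`! ^ 2 * 'C(m.+1, 2 *
  d))%:R :> R.
  rewrite -natrM mulnA -mulnn CE [(_`! * _)%N]mulnC bin_ffact.
  apply: le_trans (_ : ((m.+1 - 2 * d) ^ (2 * d))%:R <= _); last by rewrite ler_nat
    ffact_ge_exp.
  rewrite natrX lerXn2r ?nnegrE ?mulr_ge0 ?(ltW e1') ?(ltW m0) //.
  apply: le_trans (_ : m.+1%:R - (2 * d)%:R <= _).
    by rewrite mulrBl mul1r lerD2l lerN2.
  by rewrite lerBlDr -natrD ler_nat; lia.
rewrite -(@ler_pM2l _ (m.+1%:R ^+ (2 * d))) ?exprn_gt0 //.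
have w0 : 0 <= (1 - e) ^+ d * vol (comb 1 1 K) by rewrite mulr_ge0 ?exprn_ge0 ?(ltW
  e1') ?(ltW D0).
have -> : m.+1%:R ^+ (2 * d) * ((1 - e) ^+ (d + 2 * d) * vol (comb 1 1 K)) =
    (1 - e) ^+ d * vol (comb 1 1 K) * ((1 - e) * m.+1%:R) ^+ (2 * d).
  by rewrite exprD exprMn; ring.
rewrite [leRHS]mulrCA; apply: le_trans (ler_wpM2l w0 h3) _.
apply: le_trans (ler_wpM2l (ler0n _ _) h1).
rewrite mulrCA ler_wpM2l ?ler0n // [leRHS]mulrAC ler_wpM2l //.
Qed.

End RogersShephard.

(** * Covering a convex body by half-sized copies *)

Section DifferenceBody.
Variables (R : realType) (d' : nat).
Let d := d'.+1.
Implicit Types (K : set 'rV[R]_d).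

Lemma body_neg K b : 0 < b -> body K -> body (comb 0 b K).
Proof.
move=> b0 bK; have K0 := body0 bK; have [cK bdK [r r0 Kr]] := bK.
have neg x : comb 0 b K x <-> scl b K (- x).
  split=> [[p [q [_ Kq ->]]]|[q Kq qx]]; first by exists q; rewrite ?scale0r ?sub0r
    ?opprK.
  by exists q, q; rewrite scale0r sub0r qx opprK.
have [cS bS [r' r'0 Sr]] := body_scl b0 bK.
split.
- move=> x y t /neg xs /neg ys t01; apply/neg.
  by rewrite opprD -!scalerN; exact: cS.
- exact: comb_bnd.
- exists r' => // x xr; apply/neg; apply: Sr => i; rewrite mxE normrN; exact: xr.
Qed.

Lemma vol_neg K b : 0 < b -> body K -> vol (comb 0 b K) = b ^+ d * vol K.
Proof.
move=> b0 bK; rewrite -vol_homogeneous //.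
have -> : comb 0 b K = [set - x | x in scl b K].
  apply/seteqP; split => [_ [p [q [_ Kq ->]]]|_ [_ [q Kq <-] <-]].
    by exists (b *: q); [exists q | rewrite scale0r sub0r].
  by exists q, q; rewrite scale0r sub0r.
have densE : dens [set - x | x in scl b K] = dens (scl b K).
  by apply/funext => n; rewrite /dens cntN //; exact: (scl_bnd _ (body_bnd bK)).
by rewrite /vol densE.
Qed.

Lemma vol_half_difference K : body K ->
  vol (comb 1 2^-1 K) <= ('C(2 * d, d)%:R `^ (d%:R^-1) - 2^-1) ^+ d * vol K.
Proof.
move=> bK; have bA : body (comb 1 2^-1 K) by exact: body_comb.
have h0 : 0 < 2^-1 :> R by rewrite invr_gt0.
have bB := body_neg h0 bK; have [cK bdK _] := bK.
have V0 := vol_gt0 bK; have W0 := vol_gt0 bA.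
have [v v0 vE] := exists_root d' (ltW V0); have [w w0 wE] := exists_root d' (ltW W0).
set c := _ `^ _.
have c0 : 0 <= c by exact: powR_ge0.
have cE : c ^+ d = 'C(2 * d, d)%:R.
  by rewrite -powR_mulrn // -powRrM mulVf ?pnatr_eq0 // powRr1.
have bm : (w + 2^-1 * v) ^+ d <= (c * v) ^+ d.
  rewrite exprMn cE vE; apply: le_trans (rogers_shephard bK).
  apply: (@brunn_minkowski _ _ _ _ _ _ _ bA bB (comb_bnd 1 1 bdK)) => //.
  - move=> x y xA yB; have := combD cK _ _ _ _ xA yB.
    by rewrite addr0 (_ : 2^-1 + 2^-1 = 1); [apply | field].
  - by rewrite mulr_ge0 // ltW.
  - by rewrite wE.
  - by rewrite vol_neg // exprMn vE.
rewrite ler_pXn2r ?nnegrE ?addr_ge0 ?mulr_ge0 ?(ltW h0) // in bm.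
rewrite -vE -wE -exprMn lerXn2r ?nnegrE //; last by rewrite mulrBl lerBrDr.
by apply: le_trans w0 _; rewrite mulrBl lerBrDr.
Qed.

Lemma vol_half_difference_sym K : body K -> (forall x, K x -> K (- x)) ->
  vol (comb 1 2^-1 K) = (3 / 2) ^+ d * vol K.
Proof.
move=> bK Ks; have [cK bdK _] := bK; rewrite -vol_homogeneous //; congr vol.
have e : 1 + 2^-1 = 3 / 2 :> R by field.
apply/seteqP; split => [_ [x [y [Kx Ky ->]]]|_ [x Kx <-]].
  have h0 : 0 <= 2^-1 :> R by rewrite invr_ge0.
  have [z Kz zE] := cvx_add cK ler01 h0 Kx (Ks y Ky).
  by exists z => //; rewrite -e -zE scalerN.
by exists x, (- x); split => //; [exact: Ks | rewrite -e scalerDl scalerN opprK].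
Qed.

End DifferenceBody.

Section Covering.
Variables (R : realType) (d' : nat).
Let d := d'.+1.
Implicit Types (K : set 'rV[R]_d).

(** The translates found greedily have the size [1 - e - dl] and are enlarged by
    [dl], so that a missed point misses a whole neighbourhood, and then by [e],
    which pays for moving points of [K] to the grid. *)
Lemma cover_at_level n k (e dl r : R) K : cvx K -> bnd K -> has_cube r K -> 0 <= r ->
  0 < e -> 0 < dl -> 2 * dl + e <= 1 -> n.+1%:R^-1 <= e / 2 * r ->
  exists2 N, covers K N 2^-1 &
    N%:R <= k%:R + (cnt n (comb 1 2^-1 K))%:R * (cnt n (scl dl K))%:R
      / (cnt n (scl (dl / 2) K))%:R ^+ 2
      * (1 - (cnt n (scl ((1 - e - dl) / 2) K))%:R / (cnt n (comb 1 2^-1 K))%:R) ^+ k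
        :> R.
Proof.
move=> cK bK Kr r0 e0 dl0 de hn.
have K0 : K 0 by apply: Kr => i; rewrite mxE normr0.
pose T := pts n (comb 1 2^-1 K).
pose c := (1 - e - dl) / 2.
pose B := pts n (comb c 0 K).
pose X := pts n (comb 1 ((e + dl) / 2) K).
pose D := pts n (comb (dl / 2) 0 K).
pose D2 := pts n (comb dl 0 K).
have c0 : 0 <= c by rewrite /c; lra.
have dl20 : 0 <= dl / 2 by lra.
have e20 : 0 <= e / 2 by lra.
have grid_pt0 : grid_pt R n 0 = 0 :> 'rV[R]_d by apply/rowP => i; rewrite !mxE mul0r.
have in0 a b : 0 \in pts n (comb a b K).
  apply/mem_ptsP; first exact: comb_bnd.
  by exists 0, 0; rewrite grid_pt0 !scaler0 subr0.
have memP a b u : reflect (comb a b K (grid_pt R n u)) (u \in pts n (comb a b K)).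
  by apply: mem_ptsP; exact: comb_bnd.
have T0 : (0 < size T)%N by rewrite -has_predT; apply/hasP; exists 0; rewrite ?in0.
have D0 : (0 < size D)%N by rewrite -has_predT; apply/hasP; exists 0; rewrite ?in0.
have D20 : (0 < size D2)%N by rewrite -has_predT; apply/hasP; exists 0; rewrite ?in0.
have XT : (size X <= size T)%N.
  by apply: cnt_mono; [exact: comb_bnd | apply: sub_comb => //; lra].
have [||ts szts hts] := @greedy_cover _ R X B T k T0.
- exact: pts_uniq.
- move=> x b /memP xX /memP bB; apply/memP; rewrite grid_ptB.
  have := combD cK _ _ _ _ xX (combN bB).
  rewrite addr0 (_ : (e + dl) / 2 + c = 2^-1); last by rewrite /c; field.
  by apply => //; lra.
(* a large intersection of D with a reflected copy of itself *)
have [||t tD2 ht] := @exists_hits_ge _ D [seq - u | u <- D] D2 D20.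
- by rewrite map_inj_uniq ?pts_uniq //; exact: oppr_inj.
- move=> x _ /memP xD /mapP[b /memP bD ->]; apply/memP; rewrite grid_ptB grid_ptN opprK.
  by have := combD cK dl20 (lexx 0) dl20 (lexx 0) xD bD; rewrite addr0 -splitr.
rewrite size_map in ht.
pose S := [seq u <- D | u - t \in [seq - u | u <- D]].
have szS : size S = hits D [seq - u | u <- D] t by rewrite size_filter.
have SP s : s \in S -> s \in D /\ t - s \in D.
  rewrite mem_filter => /andP[/mapP[b bD sb] sD]; split => //.
  by rewrite -(opprB s t) sb opprK.
rewrite -szS in ht.
have S0 : (0 < size S)%N.
  by rewrite lt0n; apply/eqP => S0; move: ht; rewrite S0 muln0 leqNgt muln_gt0 D0.
pose E := pts n (comb ((1 - e) / 2) 0 K).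
pose P := pts n (comb 1 (e / 2) K).
pose Y := [seq y <- P | ~~ has (fun u => y - u \in E) ts].
pose V := uncovered X B ts.
have [|||J [szJ JY JP]] := @maximal_packing _ Y S V.
- by rewrite filter_uniq ?pts_uniq.
- by rewrite filter_uniq ?pts_uniq.
- move=> y s + /SP[/memP sD _]; rewrite !mem_filter => /andP[nc /memP yP].
  have ysX : comb 1 ((e + dl) / 2) K (grid_pt R n (y - s)).
    have := combD cK _ _ _ _ yP (combN sD); rewrite addr0 grid_ptB -mulrDl.
    by apply => //; lra.
  have -> /= : (y - s \in X) by apply/memP.
  rewrite andbT; apply: contra nc => /hasP[u uts /memP uB]; apply/hasP; exists u => //.
  apply/memP; have := combD cK c0 (lexx 0) dl20 (lexx 0) uB sD.
  rewrite -grid_ptD addr0 addrAC subrK.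
  by rewrite (_ : c + dl / 2 = (1 - e) / 2) // /c; field.
pose tr := [seq grid_pt R n u | u <- ts] ++ [seq grid_pt R n (y - t) | y <- J].
have covers_by x v : v \in tr -> comb 2^-1 0 K (x - v) ->
    (\bigcup_(i in [set: 'I_(size tr)]) [set 2^-1 *: x0 + tr`_i | x0 in K]) x.
  move=> vtr [p [q [Kp _ pE]]]; have vi : (index v tr < size tr)%N by rewrite index_mem.
  exists (Ordinal vi) => //=; exists p => //; rewrite nth_index //.
  by move: pE; rewrite scale0r subr0 => <-; rewrite subrK.
have sub3 (a b c' : 'rV[R]_d) : a - b + (c' - a) = c' - b.
  by rewrite addrC addrA subrK.
exists (size tr).
  exists (fun i => tr`_i) => y Ky.
  have [g hg] := near_grid_pt n y.
  have wK : comb (e / 2) 0 K (y - grid_pt R n g).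
    rewrite comb_pos //; apply: (scl_cube (r := r)) => //; first by lra.
    by move=> i; apply: le_trans hn; have := hg i; rewrite !mxE.
  have gP : g \in P.
    apply/memP; have h1 : comb 1 0 K y by exists y, 0; rewrite scale1r scale0r subr0.
    have := combD cK ler01 (lexx 0) (lexx 0) e20 h1 (combN wK).
    by rewrite addr0 add0r subKr.
  have [/hasP[u uts /memP uE]|ng] := boolP (has (fun u => g - u \in E) ts).
    apply: (covers_by _ (grid_pt R n u)).
      by rewrite mem_cat map_f.
    have := combD cK _ (lexx 0) e20 (lexx 0) uE wK; rewrite addr0 -mulrDl subrK mul1r.
    rewrite grid_ptB sub3.
    by apply; lra.
  have [|y' [s [s' [y'J sS s'S ss']]]] := JP g _ S0; first by rewrite mem_filter ng.
  apply: (covers_by _ (grid_pt R n (y' - t))).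
    by rewrite mem_cat (map_f (fun y => grid_pt R n (y - t))) ?orbT.
  have [/memP sD _] := SP s sS; have [_ /memP s'D] := SP s' s'S.
  have := combD cK _ _ e20 (lexx 0) (combD cK dl20 (lexx 0) dl20 (lexx 0) sD s'D) wK.
  rewrite !addr0 -splitr => h.
  have := h _ (lexx 0); rewrite -grid_ptD.
  have -> : s + (t - s') = g - (y' - t).
    have -> : g = y' - s' + s by rewrite -ss' subrK.
    by apply/rowP => i; rewrite !mxE; ring.
  rewrite grid_ptB sub3 => {}h.
  apply: (sub_comb cK K0 _ _ (h _)); lra.
rewrite size_cat !size_map szts natrD lerD2l.
have SR : 0 < (size S)%:R :> R by rewrite ltr0n.
have DR : 0 < (size D)%:R :> R by rewrite ltr0n.
have D2R : 0 < (size D2)%:R :> R by rewrite ltr0n.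
set q := (1 - _ / _) ^+ k.
have BT : (size B <= size T)%N.
  by apply: cnt_mono; [exact: comb_bnd | apply: sub_comb => //; rewrite /c; lra].
have TR : 0 < (size T)%:R :> R by rewrite ltr0n.
have q0 : 0 <= q.
  rewrite exprn_ge0 // subr_ge0 ler_pdivrMr // mul1r ler_nat.
  by move: BT; rewrite /B comb_pos.
have VT : (size V)%:R <= (size T)%:R * q.
  apply: le_trans (_ : (size X)%:R * q <= _); first by rewrite /q -comb_pos.
  by rewrite ler_wpM2r // ler_nat.
rewrite -!comb_pos //.
have JS : (size J)%:R * (size S)%:R <= (size T)%:R * q.
  by apply: le_trans VT; rewrite -natrM ler_nat.
have DS : (size D)%:R ^+ 2 <= (size D2)%:R * (size S)%:R :> R.
  by rewrite expr2 -!natrM ler_nat.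
rewrite mulrAC ler_pdivlMr ?exprn_gt0 //.
apply: le_trans (ler_wpM2l (ler0n R (size J)) DS) _.
rewrite mulrCA [leRHS]mulrAC [leRHS]mulrC.
exact: ler_wpM2l (ltW D2R) _ _ JS.
Qed.

Lemma cvg_exprn (f : nat -> R) (a : R) k : f @ ufil --> a ->
  (fun n => f n ^+ k) @ ufil --> a ^+ k.
Proof.
move=> fa; elim: k => [|k IH].
  by rewrite expr0 (_ : (fun n => _) = fun=> 1); [exact: cvg_cst | apply/funext => n;
    rewrite expr0].
rewrite exprS (_ : (fun n => _) = fun n => f n * f n ^+ k); last first.
  by apply/funext => n; rewrite exprS.
exact: cvgM.
Qed.

(** The number [k] of greedy steps is chosen so that the leftover, which decays
    like [exp (- q k)], balances the packing ratio [Q (2 / dl)^d] up to [Q]. *)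
Lemma covering_bound K (e dl : R) : body K -> 0 < e -> 0 < dl -> 2 * dl + e <= 1 ->
  let Q := vol (comb 1 2^-1 K) / vol (scl 2^-1 K) in
  exists2 N, covers K N 2^-1 &
    N%:R <= Q / (1 - e - dl) ^+ d * (d%:R * ln (2 / dl)) + Q + 2 :> R.
Proof.
have addE (x k p Q : R) : k <= x + 1 -> p <= Q + 1 -> k + p <= x + Q + 2 by lra.
move=> bK e0 dl0 de Q; have [cK bdK [r r0 Kr]] := bK.
have h2 : 0 < 2^-1 :> R by rewrite invr_gt0.
have bT : body (comb 1 2^-1 K) by exact: body_comb.
have W0 := vol_gt0 bT; have V0 := vol_gt0 bK.
have L0 := vol_gt0 (body_scl h2 bK).
have LE := vol_homogeneous bK h2.
have Q1 : 1 <= Q.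
  rewrite ler_pdivlMr // mul1r; apply: vol_le; first exact: body_bnd bT.
  have K0 := body0 bK.
  by rewrite -comb_pos //; apply: sub_comb => //; lra.
have Q0 : 0 < Q by apply: lt_le_trans Q1.
have s0 : 0 < 1 - e - dl by lra.
pose q := (1 - e - dl) ^+ d / Q.
have q0 : 0 < q by rewrite divr_gt0 // exprn_gt0.
have q1 : q <= 1.
  rewrite ler_pdivrMr // mul1r; apply: le_trans Q1; rewrite exprn_ile1 //; lra.
have ln0 : 0 <= ln (2 / dl) by rewrite ln_ge0 // ler_pdivlMr //; lra.
pose x := q^-1 * (d%:R * ln (2 / dl)).
have x0 : 0 <= x by rewrite !mulr_ge0 ?invr_ge0 // ltW.
pose k := (Num.truncn x).+1.
have /andP[kx xk] := truncn_itv x0.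
pose p n := (cnt n (comb 1 2^-1 K))%:R * (cnt n (scl dl K))%:R
      / (cnt n (scl (dl / 2) K))%:R ^+ 2
      * (1 - (cnt n (scl ((1 - e - dl) / 2) K))%:R / (cnt n (comb 1 2^-1 K))%:R) ^+ k
        : R.
have pE : p = fun n => dens (comb 1 2^-1 K) n * dens (scl dl K) n / dens (scl (dl /
  2) K) n ^+ 2
      * (1 - dens (scl ((1 - e - dl) / 2) K) n / dens (comb 1 2^-1 K) n) ^+ k.
  apply/funext => n; have N0 : n.+1%:R ^+ d != 0 :> R by rewrite expf_neq0 // pnatr_eq0.
  have divE (a b c : R) : c != 0 -> (a / c) / (b / c) = a / b.
    by move=> c0; rewrite invf_div mulrA divfK.
  rewrite /p /dens divE //; congr (_ * _); rewrite !expr2.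
  by rewrite !mulf_div divE // mulf_neq0.
have dl20 : 0 < dl / 2 by lra.
have s20 : 0 < (1 - e - dl) / 2 by lra.
have cd A : body A -> dens A n @[n --> ufil] --> vol A.
  by move=> /body_bnd; exact: cvg_dens.
have pcvg : p n @[n --> ufil] --> vol (comb 1 2^-1 K) * vol (scl dl K) / vol (scl (dl
  / 2) K) ^+ 2
    * (1 - vol (scl ((1 - e - dl) / 2) K) / vol (comb 1 2^-1 K)) ^+ k.
  rewrite pE.
  apply: cvgM.
    apply: cvgM; first by apply: cvgM; apply: cd => //; exact: body_scl.
    apply: cvgV; first by rewrite expf_neq0 // gt_eqF // vol_gt0 //; exact: body_scl.
    by apply: cvg_exprn; apply: cd; exact: body_scl.
  apply: cvg_exprn; apply: cvgB; first exact: cvg_cst.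
  apply: cvgM; first by apply: cd; exact: body_scl.
  by apply: cvgV; [rewrite gt_eqF | exact: cd].
rewrite !vol_homogeneous // in pcvg.
have plim : vol (comb 1 2^-1 K) * (dl ^+ d * vol K) / ((dl / 2) ^+ d * vol K) ^+ 2
    * (1 - ((1 - e - dl) / 2) ^+ d * vol K / vol (comb 1 2^-1 K)) ^+ k < Q + 1.
  have -> : ((1 - e - dl) / 2) ^+ d * vol K / vol (comb 1 2^-1 K) = q.
    by rewrite /q /Q LE exprMn; field; rewrite !gt_eqF // exprn_gt0.
  have -> : vol (comb 1 2^-1 K) * (dl ^+ d * vol K) / ((dl / 2) ^+ d * vol K) ^+ 2 =
    Q * (2 / dl) ^+ d.
    rewrite /Q LE !exprMn !exprVn; field.
    by rewrite !gt_eqF // exprn_gt0.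
  apply: le_lt_trans (_ : Q < _); last by rewrite ltrDl.
  have kb : (1 - q) ^+ k <= ((2 / dl) ^+ d)^-1.
    apply: le_trans (_ : expR (- q) ^+ k <= _).
      by rewrite lerXn2r ?nnegrE ?subr_ge0 ?expR_ge0 // expR_ge1Dx.
    have -> : ((2 / dl) ^+ d)^-1 = expR (- (d%:R * ln (2 / dl))).
      by rewrite expRN expRM_natl lnK // posrE divr_gt0.
    rewrite -expRM_natr ler_expR mulNr lerN2.
    have -> : d%:R * ln (2 / dl) = q * x by rewrite /x mulVKf // gt_eqF.
    by rewrite ler_pM2l // ltW.
  rewrite -mulrA -[leRHS]mulr1 ler_pM2l //.
  by rewrite mulrC -ler_pdivlMr ?div1r // exprn_gt0 // divr_gt0.
have [n [np nn]] := filter_ex (filterI (cvgr_lt _ pcvg _ plim) (near_small (mulr_gt0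
  (divr_gt0 e0 (ltr0Sn R 1)) r0))).
have [N cN hN] := @cover_at_level n k e dl r K cK bdK Kr (ltW r0) e0 dl0 de nn.
exists N => //; apply: le_trans hN _; rewrite -/(p n).
have kb : k%:R <= x + 1 by rewrite -natr1 lerD2r.
have xE : x = Q / (1 - e - dl) ^+ d * (d%:R * ln (2 / dl)) by rewrite /x /q invf_div.
rewrite -xE; exact: addE kb (ltW np).
Qed.

End Covering.

(** * Numerical estimates *)

Section Numeric.
Variable R : realType.
Implicit Types (d : nat).

Lemma ln_ge1BV (x : R) : 0 < x -> 1 - x^-1 <= ln x.
Proof.
move=> x0; have xi0 : 0 < x^-1 by rewrite invr_gt0.
rewrite -[leRHS]opprK -lnV ?posrE // lerNr opprB.
by have := @le_ln1Dx R (x^-1 - 1) _; rewrite addrCA subrr addr0; apply; rewrite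
  ltrBrDr addNr.
Qed.

Lemma ln_le_sub1 (x : R) : 0 < x -> ln x <= x - 1.
Proof.
by move=> x0; have := @le_ln1Dx R (x - 1) _; rewrite addrCA subrr addr0; apply;
  rewrite ltrBrDr addNr.
Qed.

Lemma ln2_ge : 7 / 12 <= ln 2 :> R.
Proof.
have -> : 2 = 4 / 3 * (3 / 2) :> R by field.
rewrite lnM ?posrE //.
have h1 : 1 - (3 / 2)^-1 <= ln (3 / 2) :> R by apply: ln_ge1BV; rewrite divr_gt0.
have h2 : 1 - (4 / 3)^-1 <= ln (4 / 3) :> R by apply: ln_ge1BV; rewrite divr_gt0.
by lra.
Qed.

(** [exp (9/4) = (exp (1/32))^72 >= (33/32)^72 > 80/9]. *)
Lemma ln_80_9_le : ln (80 / 9) <= 9 / 4 :> R.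
Proof.
rewrite -[leRHS]expRK ler_ln ?posrE ?expR_gt0 //.
have -> : 9 / 4 = 72%:R * 32^-1 :> R by field.
rewrite expRM_natl.
have h1 : 33 / 32 <= expR 32^-1 :> R.
  by have := @expR_ge1Dx R 32^-1; lra.
move: (expR 32^-1) h1 => x h1.
have x0 : 0 <= x by lra.
have h8 : 1278 / 1000 <= x ^+ 8.
  apply: le_trans (_ : (33 / 32) ^+ 8 <= _); first by lra.
  by rewrite lerXn2r ?nnegrE //; lra.
rewrite (_ : 72%N = (8 * 9)%N) // exprM; move: (x ^+ 8) h8 => y h8.
apply: le_trans (_ : (1278 / 1000) ^+ 9 <= _); first by lra.
by apply: lerXn2r; [rewrite nnegrE; lra | rewrite nnegrE; lra | exact: h8].
Qed.

Lemma ln_nat_ge d : (2 <= d)%N -> 7 / 12 <= ln d%:R :> R.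
Proof.
by move=> d2; apply: le_trans ln2_ge _; rewrite ler_ln ?posrE ?ltr0n ?ler_nat //; lia.
Qed.

(** The total shrinking is [e + dl = 1/(4 d ln d)], with [dl] nine tenths of it.
    By Bernoulli's inequality it costs the factor [1 / (1 - 1/(4 u))] with
    [u = ln d], while [ln (2 / dl)] is [u + ln u + ln (80/9)]. The claim then
    reduces to [ln u + 17/4 <= 7 u], which follows from [ln u <= u - 1] and
    [u >= ln 2 >= 7/12]. *)
Lemma greedy_parameters d : (2 <= d)%N ->
  exists e dl : R, [/\ 0 < e, 0 < dl, 2 * dl + e <= 1 &
    (d%:R * ln (2 / dl)) / (1 - e - dl) ^+ d + 3 / 2 <= d%:R * (ln d%:R + ln (ln
      d%:R) + 5)].
Proof.
move=> d2; have u0 := ln_nat_ge d2; set u := ln d%:R in u0 *.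
have D2 : 2 <= d%:R :> R by rewrite ler_nat.
have upos : 0 < u by lra.
have Dpos : 0 < d%:R :> R by lra.
have Du : 7 / 6 <= d%:R * u.
  apply: le_trans (_ : 2 * u <= _); first by lra.
  by rewrite ler_wpM2r // ltW.
pose eta := (4 * (d%:R * u))^-1.
have eta0 : 0 < eta by rewrite invr_gt0; lra.
have eta1 : eta <= 3 / 14.
  by rewrite -[leRHS]invrK lef_pV2 ?posrE ?invr_gt0 ?divr_gt0 //; lra.
exists (eta / 10), (9 * eta / 10); split; [lra | lra | lra |].
have -> : 1 - eta / 10 - 9 * eta / 10 = 1 - eta by field.
have lnE : ln (2 / (9 * eta / 10)) = ln (80 / 9) + (u + ln u).
  have -> : 2 / (9 * eta / 10) = 80 / 9 * (d%:R * u).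
    by rewrite /eta; field; rewrite !gt_eqF.
  by rewrite !lnM ?posrE ?mulr_gt0 // -/u.
have lnu := ln_le_sub1 upos.
have lnu' : - (5 / 7) <= ln u.
  apply: le_trans (ln_ge1BV upos).
  have : u^-1 <= 12 / 7 by rewrite -[leRHS]invrK lef_pV2 ?posrE ?invr_gt0 ?divr_gt0
    //; lra.
  by lra.
have ln80 := ln_80_9_le.
have ln80' : 0 <= ln (80 / 9) :> R by rewrite ln_ge0 //; lra.
have t0 : 0 < 1 - (4 * u)^-1.
  rewrite subr_gt0 invf_lt1; lra.
have tE : 1 - (4 * u)^-1 <= (1 - eta) ^+ d.
  have -> : (4 * u)^-1 = d%:R * eta by rewrite /eta; field; rewrite !gt_eqF.
  by apply: bernoulli; lra.
have -> : d%:R * (u + ln u + 5) = d%:R * (u + ln u + 17 / 4) + d%:R * (3 / 4) by field.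
apply: lerD; last by lra.
rewrite -mulrA ler_wpM2l ?(ltW Dpos) // lnE ler_pdivrMr ?(lt_le_trans t0) //.
apply: le_trans (_ : (u + ln u + 17 / 4) * (1 - (4 * u)^-1) <= _); last first.
  by rewrite ler_wpM2l //; lra.
rewrite mulrBr mulr1 lerBrDr -lerBrDl ler_pdivrMr; last by lra.
set l := ln (80 / 9) in ln80 ln80' *; set w := ln u in lnu lnu' *.
have : 8 * u <= (u + w + 17 / 4 - (l + (u + w))) * (4 * u).
  rewrite (_ : 8 * u = 2 * (4 * u)); last by ring.
  by rewrite ler_wpM2r; lra.
by lra.
Qed.

(** The factor [3 d + 1] instead of [d] makes the induction close. *)
Lemma central_binomial_le d : ('C(2 * d, d) ^ 2 * (3 * d + 1) <= 16 ^ d)%N.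
Proof.
elim: d => [|d IH]; first by [].
have E : (d.+1 * 'C(2 * d.+1, d.+1) = 2 * (2 * d + 1) * 'C(2 * d, d))%N.
  have -> : (2 * d.+1 = (2 * d).+2)%N by lia.
  have h1 : 'C((2 * d).+2, d.+1) = (2 * 'C((2 * d).+1, d.+1))%N.
    have sym : 'C((2 * d).+1, d) = 'C((2 * d).+1, d.+1).
      rewrite -(@bin_sub (2 * d).+1 d); last by lia.
      by rewrite (_ : (2 * d).+1 - d = d.+1)%N //; lia.
    by rewrite binS sym addnn -mul2n.
  have h2 : (d.+1 * 'C((2 * d).+1, d.+1) = (2 * d).+1 * 'C(2 * d, d))%N.
    by rewrite -mul_bin_diag.
  by rewrite h1 mulnCA h2; lia.
set c := 'C(2 * d, d) in IH E; set c' := 'C(_, _) in E *.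
rewrite -(@leq_pmul2l (d.+1 ^ 2 * (3 * d + 1))) ?muln_gt0 ?expn_gt0 //; last by lia.
rewrite (_ : d.+1 ^ 2 * (3 * d + 1) * (c' ^ 2 * (3 * d.+1 + 1)) =
   (d.+1 * c') ^ 2 * (3 * d + 1) * (3 * d.+1 + 1))%N; last by lia.
rewrite E (_ : (2 * (2 * d + 1) * c) ^ 2 * (3 * d + 1) * (3 * d.+1 + 1) =
  (c ^ 2 * (3 * d + 1)) * (4 * (2 * d + 1) ^ 2 * (3 * d.+1 + 1)))%N; last by lia.
rewrite (expnS 16) (_ : d.+1 ^ 2 * (3 * d + 1) * (16 * 16 ^ d) =
  16 ^ d * (16 * (d.+1 ^ 2 * (3 * d + 1))))%N; last by lia.
by apply: leq_mul => //; lia.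
Qed.

End Numeric.

(** * Asymptotics, the covering index and reduction to centred bodies *)

Section Asymptotics.
Variable R : realType.

Definition logsum d : R := ln d%:R + ln (ln d%:R) + 5.

Lemma logsum_bounds d : (2 <= d)%N -> 0 <= logsum d <= 9 * ln d%:R.
Proof.
move=> d2; rewrite /logsum; have u0 := ln_nat_ge R d2.
move: (ln d%:R) u0 => u u0.
have upos : 0 < u by lra.
have h1 := ln_le_sub1 upos; have h2 := ln_ge1BV upos.
have h3 : u^-1 <= 12 / 7 by rewrite -[leRHS]invrK lef_pV2 ?posrE ?invr_gt0 ?divr_gt0
  //; lra.
move: (ln u) (u^-1) h1 h2 h3 => l v h1 h2 h3.
by apply/andP; split; lra.
Qed.

(** With [s^d = 1 / sqrt d] and [s <= 1], the root is at most [4 s], and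
    [4 s - 1/2 <= (7/2) s]. *)
Lemma central_binomial_root_le d : (0 < d)%N ->
  0 <= 'C(2 * d, d)%:R `^ (d%:R^-1) - 2^-1 :> R /\
  ('C(2 * d, d)%:R `^ (d%:R^-1) - 2^-1) ^+ d * Num.sqrt d%:R <= (7 / 2) ^+ d :> R.
Proof.
case: d => // d' _; set d := d'.+1; set c := _ `^ _.
have C0 : 1 <= 'C(2 * d, d)%:R :> R by rewrite ler1n bin_gt0; lia.
have c0 : 0 <= c by exact: powR_ge0.
have cE : c ^+ d = 'C(2 * d, d)%:R.
  by rewrite -powR_mulrn // -powRrM mulVf ?pnatr_eq0 // powRr1.
have c1 : 1 <= c.
  by rewrite -(@ler_pXn2r _ d) ?nnegrE // expr1n cE.
split; first by lra.
have d1 : 1 <= d%:R :> R by rewrite ler1n.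
have sq1 : 1 <= Num.sqrt d%:R :> R by rewrite -[leLHS]sqrtr1 ler_sqrt // ltW //; lra.
have sq0 : 0 < Num.sqrt d%:R :> R by lra.
have sqV0 : 0 <= (Num.sqrt d%:R)^-1 :> R by rewrite invr_ge0 ltW.
have [s s0 sE] := exists_root d' sqV0.
have s1 : s <= 1.
  by rewrite -(@ler_pXn2r _ d) ?nnegrE // expr1n sE invf_le1.
have Csq : 'C(2 * d, d)%:R * Num.sqrt d%:R <= 4 ^+ d :> R.
  rewrite -(@ler_pXn2r _ 2) ?nnegrE ?mulr_ge0 ?ler0n ?exprn_ge0 ?(ltW sq0) //.
  rewrite exprMn sqr_sqrtr ?ler0n // exprAC -natrX -natrM.
  rewrite (_ : 4 ^+ 2 = 16%:R :> R); last by rewrite -natrX.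
  rewrite -natrX ler_nat.
  by apply: leq_trans (central_binomial_le d); rewrite leq_mul2l; apply/orP; right; lia.
have c4s : c <= 4 * s.
  rewrite -(@ler_pXn2r _ d) ?nnegrE ?mulr_ge0 // cE exprMn sE.
  by rewrite ler_pdivlMr.
apply: le_trans (_ : (7 / 2 * s) ^+ d * Num.sqrt d%:R <= _).
  by rewrite ler_wpM2r ?(ltW sq0) // lerXn2r ?nnegrE //; lra.
by rewrite exprMn sE divfK // gt_eqF.
Qed.

Lemma symmetric_bound_bigO :
  (fun d : nat => 3 ^+ d * (2 * d%:R) * logsum d : R)
    =O_\oo (fun d : nat => 3 ^+ d * d%:R * ln d%:R : R).
Proof.
apply/eqO_exP; exists 18 => //; near=> d.
have d2 : (2 <= d)%N by near: d; exists 2%N.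
have /andP[L0 L9] := logsum_bounds d2; have u0 := ln_nat_ge R d2.
have w0 : 0 <= 3 ^+ d * d%:R :> R by rewrite mulr_ge0 ?exprn_ge0.
rewrite (_ : 3 ^+ d * (2 * d%:R) * logsum d = 2 * (3 ^+ d * d%:R) * logsum d); last
  by ring.
move: (3 ^+ d * d%:R) (logsum d) (ln d%:R) w0 L0 L9 u0 => w L u w0 L0 L9 u0.
have u1 : 0 <= u by lra.
have w1 : 0 <= 2 * w by lra.
rewrite !ger0_norm ?mulr_ge0 //.
by apply: le_trans (ler_wpM2l w1 L9) _; rewrite le_eqVlt; apply/orP; left; apply/eqP;
  ring.
Unshelve. all: by end_near.
Qed.

Lemma general_bound_bigO :
  (fun d : nat => 2 ^+ d.+1 * ('C(2 * d, d)%:R `^ (d%:R^-1) - 2^-1) ^+ d * d%:R *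
    logsum d : R)
    =O_\oo (fun d : nat => 7 ^+ d * Num.sqrt d%:R * ln d%:R : R).
Proof.
apply/eqO_exP; exists 18 => //; near=> d.
have d2 : (2 <= d)%N by near: d; exists 2%N.
have /andP[L0 L9] := logsum_bounds d2; have u0 := ln_nat_ge R d2.
have [c0 cle] := central_binomial_root_le (ltnW d2).
move: (_ - 2^-1) c0 cle => c c0 cle.
have sd : d%:R = Num.sqrt d%:R * Num.sqrt d%:R :> R by rewrite -expr2 sqr_sqrtr.
have sq0 : 0 <= Num.sqrt d%:R :> R by exact: sqrtr_ge0.
have -> : 2 ^+ d.+1 * c ^+ d * d%:R * logsum d =
    2 * 2 ^+ d * (c ^+ d * Num.sqrt d%:R) * Num.sqrt d%:R * logsum d.
  by rewrite exprS [in LHS]sd; ring.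
have cd1 : 0 <= c ^+ d by exact: exprn_ge0.
have cd0 : 0 <= c ^+ d * Num.sqrt d%:R by exact: mulr_ge0.
have t0 : 0 <= 2 ^+ d :> R by rewrite exprn_ge0.
have E7 : 2 ^+ d * (7 / 2) ^+ d = 7 ^+ d :> R.
  by rewrite -exprMn; congr (_ ^+ _); field.
have s70 : 0 <= 7 ^+ d :> R by rewrite exprn_ge0.
have uge : 0 <= ln d%:R :> R by lra.
rewrite !ger0_norm ?mulr_ge0 //.
have -> : 18 * (7 ^+ d * Num.sqrt d%:R * ln d%:R) =
   2 * 2 ^+ d * (7 / 2) ^+ d * Num.sqrt d%:R * (9 * ln d%:R) :> R.
  by rewrite -E7; ring.
have P0 : 0 <= 2 * 2 ^+ d * (c ^+ d * Num.sqrt d%:R) * Num.sqrt d%:R.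
  by do 3 (apply: mulr_ge0 => //).
apply: ler_pM => //.
by rewrite ler_wpM2r // ler_wpM2l // mulr_ge0.
Unshelve. all: by end_near.
Qed.

End Asymptotics.

Section Coin.
Variables (R : realType) (d : nat).
Implicit Types K : set 'rV[R]_d.

Lemma covgamma_le K m l : 0 < l -> covers K m l -> covgamma K m <= l.
Proof.
move=> l0 cl; apply: ge_inf; last by split.
by exists 0 => x [/ltW].
Qed.

Lemma coin_le K : K !=set0 -> (coin K <= 2%:E * covnum K 2^-1)%E.
Proof.
move=> [x Kx]; rewrite -lee_pdivrMl //.
apply: le_ereal_inf_tmp => _ [m cm <-].
have m0 : (0 < m)%N by case: m cm => // -[t /(_ x Kx)[[]]].
have g : covgamma K m <= 2^-1 by apply: covgamma_le; rewrite ?invr_gt0.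
rewrite lee_pdivrMl //; apply: le_trans (ereal_inf_lbound _) _.
  by exists m.
rewrite -EFinM lee_fin ler_pdivrMr; last by lra.
have : 0 <= m%:R :> R by rewrite ler0n.
nra.
Qed.

(** Covering numbers do not depend on the position of [K], so that the origin
    may be assumed to lie in the interior. *)
Lemma covers_transl K c m l : covers [set x - c | x in K] m l -> covers K m l.
Proof.
move=> [t ht]; exists (fun i => t i + c - l *: c) => x Kx.
have [i _ [_ [k Kk <-] kE]] := ht (x - c) (ex_intro2 _ _ x Kx erefl).
exists i => //; exists k => //.
by rewrite -[RHS](subrK c) -kE scalerBr; apply/rowP => j; rewrite !mxE; ring.
Qed.

End Coin.

Section ConvexBody.
Variables (R : realType) (d' : nat).
Let d := d'.+1.
Implicit Types K : set 'rV[R]_d.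

Lemma convex_set_cvx K : convex_set K -> cvx K.
Proof.
move=> cK x y t Kx Ky /andP[t0 t1].
by have := cK x y (Itv01 t0 t1); rewrite !inE => /(_ Kx Ky).
Qed.

Lemma coord_le_norm (x : 'rV[R]_d) i : `|x 0 i| <= `|x|.
Proof.
rewrite [leRHS]/Num.Def.normr /= mx_normrE; apply/bigmax_geP; right => /=.
by exists (0, i).
Qed.

Lemma compact_bnd K : compact K -> bnd K.
Proof.
move=> /compact_bounded[M [Mreal hM]]; exists (M + 1) => x Kx i.
by apply: le_trans (hM (M + 1) _ _ Kx); [exact: coord_le_norm | rewrite ltrDl].
Qed.

Lemma convex_body_transl K : convex_body K ->
  exists c, body [set x - c | x in K].
Proof.
move=> [kK cK [c]]; rewrite /interior /= => /nbhs_ballP[r /= r0 cr].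
have bK := compact_bnd kK; have {}cK := convex_set_cvx cK.
exists c; split.
- move=> _ _ t [x Kx <-] [y Ky <-] t01; exists (t *: x + (1 - t) *: y); first exact: cK.
  by apply/rowP => i; rewrite !mxE; ring.
- have [M KM] := bK; exists (M + `|c|) => _ [x Kx <-] i.
  rewrite !mxE; apply: le_trans (ler_normB _ _) _; by rewrite lerD ?KM ?coord_le_norm.
- exists (r / 2); first by rewrite divr_gt0.
  move=> x xr; exists (x + c); last by rewrite addrK.
  apply: cr; split => // i j; rewrite ord1 -ball_normE /= mxE opprD addrCA subrr
    addr0 normrN.
  by apply: le_lt_trans (xr j) _; rewrite ltr_pdivrMr // ltr_pMr // ltr1n.
Qed.

(** A symmetric body has the origin in its interior: average a cube inside
    [K] with its reflection. *)
Lemma o_symmetric_transl K : convex_body K -> o_symmetric K -> body K.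
Proof.
move=> bK Ks; have [c] := convex_body_transl bK.
have [kK cK _] := bK; move=> [_ _ [r r0 cr]]; split.
- exact: convex_set_cvx.
- exact: compact_bnd.
- exists r => // x xr.
  have [p Kp pE] := cr x xr; have [q Kq qE] := cr (- x) (fun i => ltac:(rewrite mxE
    normrN; exact: xr)).
  have Kq' : K (- q) by rewrite Ks; exists q.
  have h01 : 0 <= (2^-1 : R) <= 1 by lra.
  have cvK : cvx K by exact: convex_set_cvx.
  have := cvK _ _ _ Kp Kq' h01.
  have pE' : p = x + c by rewrite -pE subrK.
  have qE' : q = - x + c by rewrite -qE subrK.
  suff -> : 2^-1 *: p + (1 - 2^-1) *: (- q) = x by [].
  rewrite pE' qE'; apply/rowP => i; rewrite !mxE.
  by move: (x 0 i) (c 0 i) => s t; field.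
Qed.

End ConvexBody.

(** * The bound on the covering number *)

Section Final.
Variables (R : realType) (d' : nat).
Let d := d'.+1.
Implicit Types K : set 'rV[R]_d.

Definition covering_ratio K : R := vol (comb 1 2^-1 K) / vol (scl 2^-1 K).

Lemma covering_ratioE K : body K ->
  covering_ratio K = 2 ^+ d * (vol (comb 1 2^-1 K) / vol K).
Proof.
move=> bK; have V0 := vol_gt0 bK.
have h2 : 0 < 2^-1 :> R by rewrite invr_gt0.
by rewrite /covering_ratio vol_homogeneous // exprVn invfM invrK mulrCA.
Qed.

Lemma covering_ratio_ge K : body K -> 2 ^+ d <= covering_ratio K.
Proof.
move=> bK; have V0 := vol_gt0 bK; have [cK bdK _] := bK.
have K0 := body0 bK.
rewrite covering_ratioE // ler_peMr ?exprn_ge0 // ler_pdivlMr // mul1r.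
apply: vol_le; first exact: comb_bnd.
rewrite -{1}[K]scl1 -comb_pos //; apply: sub_comb => //; first by rewrite ler01 lexx.
by rewrite lexx invr_ge0 ler0n.
Qed.

(** Since [Q >= 2^d >= 4], the additive constant [2] of [covering_bound] is at
    most [Q / 2]. *)
Lemma covnum_le K c (Q : R) : (2 <= d)%N -> body [set x - c | x in K] ->
  covering_ratio [set x - c | x in K] <= Q ->
  (2%:E * covnum K 2^-1 <= (2 * (Q * (d%:R * logsum R d)))%:E)%E.
Proof.
move=> d2 bK qQ; have [e [dl [e0 dl0 de num]]] := greedy_parameters R d2.
have [N cN] := covering_bound bK e0 dl0 de.
rewrite -/(covering_ratio _); set q := covering_ratio _ in qQ * => hN.
have q4 : 4 <= q.
  apply: le_trans (covering_ratio_ge bK); rewrite -/d.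
  apply: le_trans (_ : 2 ^+ 2 <= _); first by rewrite expr2; lra.
  by rewrite ler_eXn2l // ltr1n.
have qN : N%:R <= q * (d%:R * logsum R d).
  apply: le_trans (_ : q * (d%:R * ln (2 / dl) / (1 - e - dl) ^+ d + 3 / 2) <= _);
    last first.
    by apply: ler_wpM2l num; lra.
  apply: le_trans hN _; rewrite mulrDr (mulrAC q) -mulrA.
  by move: (q * (_ * _)) => y; lra.
have L0 : 0 <= d%:R * logsum R d.
  by rewrite mulr_ge0 //; have /andP[] := logsum_bounds R d2.
apply: le_trans (_ : 2%:E * N%:R%:E <= _)%E.
  rewrite lee_pmul2l //; apply: ereal_inf_lbound; exists N => //.
  exact: covers_transl cN.
rewrite -EFinM lee_fin ler_pM2l //; apply: le_trans qN _.
exact: ler_wpM2r.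
Qed.

End Final.

Theorem corollary7p3 (R : realType) :
  [/\ forall (d : nat) (K : set 'rV[R]_d), (2 <= d)%N -> convex_body K ->
        [/\ (coin K <= 2%:E * covnum K 2^-1)%E,
            o_symmetric K ->
              (2%:E * covnum K 2^-1 <=
                (3 ^+ d * (2 * d%:R) *
                  (ln d%:R + ln (ln d%:R) + 5))%:E)%E
          & ~ o_symmetric K ->
              (2%:E * covnum K 2^-1 <=
                (2 ^+ d.+1 * ('C(2 * d, d)%:R `^ (d%:R^-1) - 2^-1) ^+ d * d%:R *
                  (ln d%:R + ln (ln d%:R) + 5))%:E)%E],
      (fun d : nat => 3 ^+ d * (2 * d%:R) *
                        (ln d%:R + ln (ln d%:R) + 5) : R)
        =O_\oo (fun d : nat => 3 ^+ d * d%:R * ln d%:R : R)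
    & (fun d : nat => 2 ^+ d.+1 * ('C(2 * d, d)%:R `^ (d%:R^-1) - 2^-1) ^+ d *
                        d%:R * (ln d%:R + ln (ln d%:R) + 5) : R)
        =O_\oo (fun d : nat => 7 ^+ d * Num.sqrt d%:R * ln d%:R : R)].
Proof.
split; [|exact: symmetric_bound_bigO|exact: general_bound_bigO].
move=> [//|d'] K d2 bK; have [c bKc] := convex_body_transl bK; split.
- by apply: coin_le; have [_ _ [x /interior_subset Kx]] := bK; exists x.
- move=> Ks; have bK0 := o_symmetric_transl bK Ks.
  have trans0 : [set x - 0 | x in K] = K.
    by apply/seteqP; split => [_ [x Kx <-]|x Kx]; [rewrite subr0 | exists x; rewrite
      ?subr0].
  have := @covnum_le R d' K 0 (3 ^+ d'.+1) d2; rewrite trans0 => /(_ bK0) h.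
  apply: le_trans (h _) _.
    have V0 := vol_gt0 bK0.
    have Kneg x : K x -> K (- x) by move=> Kx; rewrite Ks; exists x.
    rewrite covering_ratioE // vol_half_difference_sym // mulfK ?gt_eqF //.
    by rewrite -exprMn mulrC divfK.
  by rewrite lee_fin le_eqVlt; apply/orP; left; apply/eqP; rewrite /logsum; ring.
- move=> _; have V0 := vol_gt0 bKc.
  set b := (_ - 2^-1) ^+ d'.+1.
  have h : covering_ratio [set x - c | x in K] <= 2 ^+ d'.+1 * b.
    rewrite covering_ratioE // ler_wpM2l ?exprn_ge0 // ler_pdivrMr //.
    exact: vol_half_difference.
  apply: le_trans (covnum_le d2 bKc h) _.
  rewrite lee_fin le_eqVlt; apply/orP; left; apply/eqP; rewrite /logsum (exprS 2 d'.+1).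
  by move: (2 ^+ d'.+1) => p; ring.
Qed.
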